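(* Let $r\in\mathbb{N}$, $r>1$, and let $\chi_1,\chi_2$ be any Dirichlet characters modulo $r$. For $\mathrm{Re}(z)>1$ and $x>0$, $$J_{r,\chi_1,\chi_2}(z,x)+x^{1-z}J_{r,\chi_2,\chi_1}\!\left(z,\frac1x\right)=-\sum_{n=1}^{\infty}\sum_{m=1}^{\infty}\frac{G(m,\chi_1)\,G(n,\chi_2)}{mn(n+mx)^{z-1}}.$$ In particular, if $\chi_1$ and $\chi_2$ are primitive, then $$J_{r,\chi_1,\chi_2}(z,x)+x^{1-z}J_{r,\chi_2,\chi_1}\!\left(z,\frac1x\right)=-G(1,\chi_1)G(1,\chi_2)\sum_{n=1}^{\infty}\sum_{m=1}^{\infty}\frac{\overline{\chi_1}(m)\,\overline{\chi_2}(n)}{mn(n+mx)^{z-1}}.$$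
   Context: Let $\zeta_r=e^{2\pi i/r}$. For a Dirichlet character $\chi$ modulo $r$ and an integer $\ell$, the Gauss sum is $G(\ell,\chi):=\sum_{j=1}^{r}\chi(j)e^{2\pi i j\ell/r}$. For Dirichlet characters $\chi_1,\chi_2$ modulo $r$, $\mathrm{Re}(z)>0$ and $x>0$, $$J_{r,\chi_1,\chi_2}(z,x):=\frac{1}{\Gamma(z)}\int_0^1\frac{\left(\log\frac1t\right)^{z-1}}{t(1-t^r)}\left(\sum_{\ell=1}^{r}G(\ell,\chi_2)t^{\ell}\right)\left(\sum_{j=1}^{r}\chi_1(j)\log\left(1-\zeta_r^{j}t^{x}\right)\right)dt,$$ with the principal branch of the logarithm; since $\chi_1(r)=0$, the term $j=r$ is absent. *)

(* Defs.v *)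
From HB Require Import structures.
From mathcomp Require Import all_boot all_order all_algebra.
From mathcomp Require Import all_classical all_reals all_analysis.
From mathcomp Require Export complex.

Set Implicit Arguments.
Unset Strict Implicit.
Unset Printing Implicit Defensive.

Import Order.TTheory GRing.Theory Num.Theory.
Import numFieldNormedType.Exports.

Local Open Scope classical_set_scope.
Local Open Scope ring_scope.
Local Open Scope complex_scope.

Section Iterated.
Variable K : numFieldType.
Implicit Type a : nat -> nat -> K.

(* The sum over n, m >= 1 of a n m, with m the inner index. *)
Definition iterated_sum a : K :=
  limn (series (fun n => limn (series (fun m => a n.+1 m.+1)))).

Definition iterated_cvg a : Prop :=
  (forall n, cvgn (series (fun m => a n.+1 m.+1))) /\
  cvgn (series (fun n => limn (series (fun m => a n.+1 m.+1)))).

End Iterated.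

Section ComplexFunctions.
Variable R : realType.
Implicit Types (z s : R[i]) (a t : R).

Definition cexp z : R[i] :=
  (expR (complex.Re z))%:C * (cos (complex.Im z) +i* sin (complex.Im z)).

(* a ^ s for real a > 0 *)
Definition cpow a s : R[i] := cexp (s * (ln a)%:C).

(* Principal argument, in ]-pi, pi] for z != 0. *)
Definition carg z : R :=
  let theta := acos (complex.Re z / Normc.normc z) in
  if 0 <= complex.Im z then theta else - theta.

Definition clog z : R[i] := ln (Normc.normc z) +i* carg z.

Definition cintegral (D : set R) (f : R -> R[i]) : R[i] :=
  (\int[@lebesgue_measure R]_(t in D) complex.Re (f t)) +i*
  (\int[@lebesgue_measure R]_(t in D) complex.Im (f t)).

(* Euler's integral; only meaningful for 0 < Re z. *)
Definition cGamma z : R[i] :=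
  cintegral `]0, +oo[ (fun t => cpow t (z - 1) * (expR (- t))%:C).

End ComplexFunctions.

Section Characters.
Variable R : realType.
Implicit Types (r : nat) (chi : int -> R[i]).

Definition dirichlet_character r chi : Prop :=
  [/\ chi 1 = 1,
      forall m n, chi (m * n) = chi m * chi n,
      forall n, chi (n + r%:Z) = chi n &
      forall n, (chi n != 0) = coprimez n r%:Z].

(* Not induced by a character modulo a proper divisor of r. *)
Definition primitive_character r chi : Prop :=
  dirichlet_character r chi /\
  forall (d : nat) (psi : int -> R[i]),
    (d %| r)%N -> (d < r)%N -> dirichlet_character d psi ->
    ~ (forall n : int, coprimez n r%:Z -> chi n = psi n).

(* exp (2 pi i k / r) *)
Definition zeta r (k : int) : R[i] := cexp ((2 * pi * k%:~R / r%:R) *i).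

Definition gauss_sum r (l : int) chi : R[i] :=
  \sum_(1 <= j < r.+1) chi j%:Z * zeta r (j%:Z * l).

Definition J r chi1 chi2 (z : R[i]) (x : R) : R[i] :=
  (cGamma z)^-1 *
  cintegral `]0, 1[ (fun t =>
    cpow (ln t^-1) (z - 1) / (t * (1 - t ^+ r))%:C *
    (\sum_(1 <= l < r.+1) gauss_sum r l%:Z chi2 * (t ^+ l)%:C) *
    (\sum_(1 <= j < r.+1)
        chi1 j%:Z * clog (1 - zeta r j%:Z * (t `^ x)%:C))).

End Characters.

(* Main.v *)
(** Expanding the geometric sum and the logarithms,
      sum_l G(l,chi2) t^l / (1 - t^r) = sum_n G(n,chi2) t^n,
      sum_j chi1(j) log(1 - zeta^j t^x) = - sum_m G(m,chi1) t^(mx) / m,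
    and Euler's integral of (log 1/t)^(z-1) t^(a-1) over ]0, 1[ is Gamma(z) a^(-z).
    So J(z, x) is - sum G(m,chi1) G(n,chi2) / m * (n + m x)^(-z), and exchanging
    the roles of m and n in J(z, 1/x) the two sums combine through
    1/m + x/n = (n + m x) / (m n).

    With s = Re z > 1 and d = (s - 1) / 2, the interchange of sum and integral is
    justified by e^(-v) <= d^d v^(-d), which majorizes all partial sums at
    u = log 1/t by a multiple of u^(s-1-d) + u^(d-1); the double series is
    dominated by a product of two convergent series because
    (n + m x)^(s-1) >= n^d (m x)^d.

    Dividing by Gamma(z) requires Gamma(z) <> 0.  If Gamma(z) = 0 then
    Gamma(z + n) = 0 for all n, whereas for Re z large the mass of u^(s-1) e^(-u)
    concentrates near u = s, where u^(iy) is almost constant. *)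

Require Import Defs.
From mathcomp Require Import all_boot all_order all_algebra.
From mathcomp Require Import all_classical all_reals all_analysis.
From mathcomp Require Import measurable_realfun.
From mathcomp Require Import ring lra.
From mathcomp Require cyclic.

Set Implicit Arguments.
Unset Strict Implicit.
Unset Printing Implicit Defensive.

Import Order.TTheory GRing.Theory Num.Theory.
Import numFieldNormedType.Exports.

Local Open Scope classical_set_scope.
Local Open Scope ring_scope.
Local Open Scope complex_scope.

(** * Complex modulus, exponential, powers and limits of sequences *)

Section ComplexBasics.
Variable R : realType.
Implicit Types (a b : R) (s z w : R[i]) (u v : nat -> R[i]).
Local Notation normc := (@Normc.normc R).

(** Both values of [J] are obtained as limits of partial sums over the squares [n, m <= r k]. The
    sides are multiples of [r] because the periodic power series has a closed form after whole
    periods. Squares are symmetric, so the two expansions are added term by term at a finite level,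
    and only the combined double series has to be dominated. A row estimate uniform in the cut then
    identifies the limit along squares with the iterated sum. The exponent [d] is half of [s - 1]
    because [(n + m x)^(s-1)] is shared equally between the two indices. At [t = 1] the same [d]
    pays for the logarithms by [u^(-d)]; the pole of the geometric sum costs [u^(-1)], and the
    integrable power [u^(d-1)] remains. The principal branch causes no jump: for [|w| < 1] the
    segment from [1] to [1 - w] stays in the right half-plane, where the argument is an arctangent.
    For primitive characters the difficulty is [G(m) = 0] when [m] shares a factor with [r]: a
    nonzero value would force the character to be induced from modulus [r / gcd(m, r)]. *)

Lemma normcE z : normc z = Num.sqrt (complex.Re z ^+ 2 + complex.Im z ^+ 2).
Proof. by case: z. Qed.

Lemma normc_ge0 z : 0 <= normc z.
Proof. by rewrite normcE sqrtr_ge0. Qed.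

Lemma normC_normc z : `|z| = (normc z)%:C.
Proof. by case: z. Qed.

Lemma normc_real a : normc a%:C = `|a|.
Proof. by rewrite /= expr0n addr0 sqrtr_sqr. Qed.

Lemma normc_nat n : normc n%:R = n%:R.
Proof. by rewrite -(rmorph_nat (real_complex R)) normc_real normr_nat. Qed.

Lemma Re_le_normc z : `|complex.Re z| <= normc z.
Proof. by rewrite normcE -sqrtr_sqr ler_wsqrtr// lerDl sqr_ge0. Qed.

Lemma Im_le_normc z : `|complex.Im z| <= normc z.
Proof. by rewrite normcE -sqrtr_sqr ler_wsqrtr// lerDr sqr_ge0. Qed.

Lemma normc_le_ReIm z : normc z <= `|complex.Re z| + `|complex.Im z|.
Proof.
case: z => a b; have -> : a +i* b = a%:C + b%:C * 'i.
  by rewrite /GRing.add /GRing.mul/=; congr Complex; ring.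
rewrite (le_trans (complex.le_normcD _ _))//.
rewrite Normc.normcM !normc_real /= expr0n expr1n add0r sqrtr1 mulr1.
by rewrite !(mul0r,mulr0,subr0,addr0,mulr1,add0r).
Qed.

Lemma normc_sum (I : Type) (r : seq I) (P : pred I) (F : I -> R[i]) :
  normc (\sum_(i <- r | P i) F i) <= \sum_(i <- r | P i) normc (F i).
Proof.
elim/big_ind2 : _ => // [|x x' y y' hx hy]; first by rewrite Normc.normc0.
by rewrite (le_trans (complex.le_normcD _ _))// lerD.
Qed.

Lemma normcX z n : normc (z ^+ n) = normc z ^+ n.
Proof.
elim: n => [|n ih]; first by rewrite !expr0 Normc.normc1.
by rewrite !exprS Normc.normcM ih.
Qed.

Lemma ReCD z w : complex.Re (z + w) = complex.Re z + complex.Re w.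
Proof. by case: z w => [? ?] [? ?]. Qed.
Lemma ImCD z w : complex.Im (z + w) = complex.Im z + complex.Im w.
Proof. by case: z w => [? ?] [? ?]. Qed.
Lemma ReCN z : complex.Re (- z) = - complex.Re z.
Proof. by case: z. Qed.
Lemma ImCN z : complex.Im (- z) = - complex.Im z.
Proof. by case: z. Qed.
Lemma ReCM z w : complex.Re (z * w) =
  complex.Re z * complex.Re w - complex.Im z * complex.Im w.
Proof. by case: z w => [? ?] [? ?]. Qed.
Lemma ImCM z w : complex.Im (z * w) =
  complex.Re z * complex.Im w + complex.Im z * complex.Re w.
Proof. by case: z w => [? ?] [? ?]. Qed.

Lemma Re_sum (I : Type) (r : seq I) (F : I -> R[i]) :
  complex.Re (\sum_(i <- r) F i) = \sum_(i <- r) complex.Re (F i).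
Proof. by elim: r => [|i r ih]; rewrite ?big_nil// !big_cons ReCD ih. Qed.

Lemma Im_sum (I : Type) (r : seq I) (F : I -> R[i]) :
  complex.Im (\sum_(i <- r) F i) = \sum_(i <- r) complex.Im (F i).
Proof. by elim: r => [|i r ih]; rewrite ?big_nil// !big_cons ImCD ih. Qed.

Lemma Re_realM (c : R) z : complex.Re (c%:C * z) = c * complex.Re z.
Proof. by rewrite ReCM/= mul0r subr0. Qed.
Lemma Im_realM (c : R) z : complex.Im (c%:C * z) = c * complex.Im z.
Proof. by rewrite ImCM/= mul0r addr0. Qed.

Lemma natrC n : n%:R = (n%:R : R)%:C :> R[i].
Proof. by rewrite rmorph_nat. Qed.

Lemma cexpD z w : cexp (z + w) = cexp z * cexp w.
Proof.
rewrite /cexp ReCD ImCD expRD cosD sinD rmorphM/=.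
rewrite mulrACA; congr (_ * _); apply/eqP; rewrite eq_complex ReCM ImCM/=.
by apply/andP; split; apply/eqP; ring.
Qed.

Lemma cexp0 : cexp 0 = 1 :> R[i].
Proof. by rewrite /cexp /= expR0 cos0 sin0 mul1r. Qed.

Lemma normc_cexp z : normc (cexp z) = expR (complex.Re z).
Proof.
rewrite /cexp Normc.normcM normc_real ger0_norm ?expR_ge0//.
by rewrite [X in _ * X]/= cos2Dsin2 sqrtr1 mulr1.
Qed.

Lemma cexp_neq0 z : cexp z != 0.
Proof.
apply/eqP => h; have := normc_cexp z; rewrite h Normc.normc0 => /esym/eqP.
by rewrite gt_eqF// expR_gt0.
Qed.

Lemma cexpN z : cexp (- z) = (cexp z)^-1.
Proof.
apply: (mulIf (cexp_neq0 z)).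
by rewrite mulVf ?cexp_neq0// -cexpD addNr cexp0.
Qed.

Lemma cexp_real a : cexp a%:C = (expR a)%:C.
Proof. by rewrite /cexp /= cos0 sin0 mulr1. Qed.

Lemma cpowD a s z : cpow a (s + z) = cpow a s * cpow a z.
Proof. by rewrite /cpow mulrDl cexpD. Qed.

Lemma cpowN a s : cpow a (- s) = (cpow a s)^-1.
Proof. by rewrite /cpow mulNr cexpN. Qed.

Lemma cpow_neq0 a s : cpow a s != 0.
Proof. exact: cexp_neq0. Qed.

Lemma cpowM a b s : 0 < a -> 0 < b -> cpow (a * b) s = cpow a s * cpow b s.
Proof. by move=> a0 b0; rewrite /cpow lnM// rmorphD/= mulrDr cexpD. Qed.

Lemma cpow_real a b : 0 < a -> cpow a b%:C = (a `^ b)%:C.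
Proof. by move=> a0; rewrite /cpow -rmorphM/= cexp_real /powR gt_eqF. Qed.

Lemma cpow1 a : 0 < a -> cpow a 1 = a%:C.
Proof. by move=> a0; rewrite /cpow mul1r cexp_real lnK. Qed.

Lemma normc_cpow a s : 0 < a -> normc (cpow a s) = a `^ complex.Re s.
Proof.
move=> a0; rewrite /cpow normc_cexp /powR gt_eqF//; congr expR.
by rewrite ReCM/= mulr0 subr0.
Qed.

Lemma Re_cpow a s : 0 < a ->
  complex.Re (cpow a s) = a `^ complex.Re s * cos (complex.Im s * ln a).
Proof.
move=> a0; rewrite /cpow /cexp ReCM/= mul0r subr0 ReCM ImCM/= !mulr0 subr0 add0r.
by rewrite /powR gt_eqF.
Qed.

(* Mathcomp-Analysis puts no topology on [R[i]] unless it is cast to a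
   [numFieldType]; limits are therefore taken through the real modulus. *)
Definition cvgc u z := normc (u n - z) @[n --> \oo] --> (0 : R).

Lemma normc_subC z w : normc (z - w) = normc (w - z).
Proof. by rewrite -complex.normcN opprB. Qed.

Lemma cvgc_le u z (e : nat -> R) : (forall n, normc (u n - z) <= e n) ->
  e n @[n --> \oo] --> 0 -> cvgc u z.
Proof.
move=> ue e0; apply: (squeeze_cvgr _ (cvg_cst 0) e0).
by apply: nearW => n; rewrite ue normc_ge0.
Qed.

Lemma cvgc_cst z : cvgc (fun=> z) z.
Proof.
rewrite /cvgc; under eq_fun do rewrite subrr Normc.normc0.
exact: cvg_cst.
Qed.

Lemma cvgc_ReIm u z : complex.Re (u n) @[n --> \oo] --> complex.Re z ->
  complex.Im (u n) @[n --> \oo] --> complex.Im z -> cvgc u z.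
Proof.
move=> hr hi.
apply: (@cvgc_le _ _ (fun n => `|complex.Re (u n) - complex.Re z| +
   `|complex.Im (u n) - complex.Im z|)).
  by move=> n; rewrite (le_trans (normc_le_ReIm _))// ReCD ImCD ReCN ImCN.
rewrite -[X in _ --> X]addr0; apply: cvgD.
  by rewrite -(normr0 R) -(subrr (complex.Re z));
    apply: cvg_norm; apply: cvgB => //; exact: cvg_cst.
by rewrite -(normr0 R) -(subrr (complex.Im z));
    apply: cvg_norm; apply: cvgB => //; exact: cvg_cst.
Qed.

Lemma cvgc_Re u z : cvgc u z -> complex.Re (u n) @[n --> \oo] --> complex.Re z.
Proof.
move=> h; apply/cvgrPdist_lt => e e0.
move/cvgrPdist_lt: h => /(_ e e0); apply: filterS => n.
rewrite sub0r normrN ger0_norm ?normc_ge0//; apply: le_lt_trans.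
by rewrite normc_subC -ReCN -ReCD Re_le_normc.
Qed.

Lemma cvgc_Im u z : cvgc u z -> complex.Im (u n) @[n --> \oo] --> complex.Im z.
Proof.
move=> h; apply/cvgrPdist_lt => e e0.
move/cvgrPdist_lt: h => /(_ e e0); apply: filterS => n.
rewrite sub0r normrN ger0_norm ?normc_ge0//; apply: le_lt_trans.
by rewrite normc_subC -ImCN -ImCD Im_le_normc.
Qed.

Lemma cvgc_unique u z w : cvgc u z -> cvgc u w -> z = w.
Proof.
move=> hz hw; apply/eqP; rewrite eq_complex.
have -> := cvg_unique (@Rhausdorff R) (cvgc_Re hz) (cvgc_Re hw).
have -> := cvg_unique (@Rhausdorff R) (cvgc_Im hz) (cvgc_Im hw).
by rewrite !eqxx.
Qed.

Lemma cvgcD u v z w : cvgc u z -> cvgc v w -> cvgc (fun n => u n + v n) (z + w).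
Proof.
move=> hu hv; apply: (@cvgc_le _ _ (fun n => normc (u n - z) + normc (v n - w))).
  by move=> n; rewrite opprD addrACA complex.le_normcD.
by rewrite -[X in _ --> X]addr0; exact: cvgD.
Qed.

Lemma cvgcN u z : cvgc u z -> cvgc (fun n => - u n) (- z).
Proof.
move=> hu; apply: (cvgc_le _ hu) => n.
by rewrite -opprD complex.normcN.
Qed.

Lemma cvgcMl u z w : cvgc u z -> cvgc (fun n => w * u n) (w * z).
Proof.
move=> hu; apply: (@cvgc_le _ _ (fun n => normc w * normc (u n - z))).
  by move=> n; rewrite -mulrBr Normc.normcM.
by rewrite -(mulr0 (normc w)); apply: cvgMr.
Qed.

Lemma cvgcM u v z w : cvgc u z -> cvgc v w -> cvgc (fun n => u n * v n) (z * w).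
Proof.
move=> hu hv; apply: cvgc_ReIm.
  rewrite ReCM; under eq_fun do rewrite ReCM.
  by apply: cvgB; apply: cvgM; (exact: cvgc_Re || exact: cvgc_Im).
rewrite ImCM; under eq_fun do rewrite ImCM.
by apply: cvgD; apply: cvgM; (exact: cvgc_Re || exact: cvgc_Im).
Qed.

Lemma cvgc_sum (I : Type) (r : seq I) (U : I -> nat -> R[i]) (L : I -> R[i]) :
  (forall i, cvgc (U i) (L i)) ->
  cvgc (fun n => \sum_(i <- r) U i n) (\sum_(i <- r) L i).
Proof.
move=> h; elim: r => [|i r ih].
  by rewrite big_nil; under eq_fun do rewrite big_nil; exact: cvgc_cst.
by rewrite big_cons; under eq_fun do rewrite big_cons; exact: cvgcD.
Qed.

(** Bridge back to the topology in which [iterated_sum] is stated. *)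
Lemma cvgc_numField u z : cvgc u z ->
  (u : nat -> (R[i] : numFieldType)) @ \oo --> (z : (R[i] : numFieldType)).
Proof.
move=> h; apply/(@cvgrPdist_lt _ (R[i] : numFieldType)) => e e0.
(* In the order of [R[i]], [0 < e] forces the imaginary part of [e] to vanish, so the radius is a
   real number. *)
case: e e0 => e e'; rewrite ltcE/= => /andP[/eqP-> e0].
move/cvgrPdist_lt: h => /(_ e e0); apply: filterS => n.
rewrite sub0r normrN ger0_norm ?normc_ge0// normc_subC => h.
by rewrite normC_normc ltcR.
Qed.

End ComplexBasics.

(** * The logarithmic series *)

Section LogSeries.
Variable R : realType.
Implicit Types (a b s : R) (z w : R[i]).
Local Notation normc := (@Normc.normc R).

(** Both sides are the angle in []-pi/2, pi/2[] with the sign of the imaginary part. Unlike [acos]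
    at its endpoint, [atan] can be differentiated across the positive real axis. *)
Lemma carg_atan z : 0 < complex.Re z ->
  carg z = atan (complex.Im z / complex.Re z).
Proof.
case: z => a b /= a0; rewrite /carg /=.
set t := atan (b / a).
have -> : a / Num.sqrt (a ^+ 2 + b ^+ 2) = cos t.
  have -> : a ^+ 2 + b ^+ 2 = a ^+ 2 * (1 + (b / a) ^+ 2).
    by field; rewrite gt_eqF.
  rewrite cos_atan sqrtrM ?sqr_ge0// sqrtr_sqr gtr0_norm//.
  by rewrite invfM mulVKf// gt_eqF.
have tpi : t < pi by rewrite (lt_trans (atan_ltpi2 _))// ltr_pdivrMr// ltr_pMr ?pi_gt0// ltr1n.
have tNpi : - pi < t.
  by rewrite (lt_trans _ (atan_gtNpi2 _))// ltrN2 ltr_pdivrMr// ltr_pMr ?pi_gt0// ltr1n.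
have t_ge0 : (0 <= t) = (0 <= b).
  apply/idP/idP => h.
    rewrite leNgt; apply/negP => b0; have : t < 0.
      by rewrite -(@atan0 R) lt_atan// pmulr_llt0// invr_gt0.
    by rewrite ltNge h.
  by rewrite -(@atan0 R) le_atan// divr_ge0// ltW.
case: ifPn => b0; first by rewrite cosK// in_itv/= t_ge0 b0 ltW.
rewrite cosKN ?opprK// (ltW tNpi)/= ltW// ltNge t_ge0//.
Qed.

Lemma is_derive_monomial (c : R) n s :
  is_derive s 1 (fun s => s ^+ n.+1 * (c / n.+1%:R)) (s ^+ n * c).
Proof.
have -> : (fun s => s ^+ n.+1 * (c / n.+1%:R)) = (c / n.+1%:R) *: (@id R ^+ n.+1).
  by apply/funext => x; rewrite /= mulrC; congr (_ * _); elim: n.+1 => // k ih; rewrite !exprS ih.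
apply: is_derive_eq.
rewrite /GRing.scale/= mulr1.
by field; rewrite addrC natr1 pnatr_eq0.
Qed.

Lemma is_derive_affine (c d : R) s : is_derive s 1 (fun s => d - s * c) (- c).
Proof.
have -> : (fun s => d - s * c) = cst d - c *: @id R.
  by apply/funext => x; rewrite fctE/= [in LHS]mulrC.
by apply: is_derive_eq; rewrite /GRing.scale/= mulr1 sub0r.
Qed.

Lemma Re_divC z w : complex.Re (z / w) =
  (complex.Re z * complex.Re w + complex.Im z * complex.Im w) /
  (complex.Re w ^+ 2 + complex.Im w ^+ 2).
Proof.
case: w => c d; have -> : (c +i* d)^-1 = (c / (c ^+ 2 + d ^+ 2)) -i* (d / (c ^+ 2 + d ^+ 2)) by [].
by rewrite ReCM/= mulrDl !mulrN opprK !mulrA.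
Qed.

Lemma Im_divC z w : complex.Im (z / w) =
  (complex.Im z * complex.Re w - complex.Re z * complex.Im w) /
  (complex.Re w ^+ 2 + complex.Im w ^+ 2).
Proof.
case: w => c d; have -> : (c +i* d)^-1 = (c / (c ^+ 2 + d ^+ 2)) -i* (d / (c ^+ 2 + d ^+ 2)) by [].
by rewrite ImCM/= mulrBl !mulrN addrC !mulrA.
Qed.

Lemma is_derive_power_sum (c : nat -> R) N s :
  is_derive s 1 (fun s => \sum_(m < N) s ^+ m.+1 * (c m / m.+1%:R))
    (\sum_(m < N) s ^+ m * c m).
Proof.
have -> : (fun s => \sum_(m < N) s ^+ m.+1 * (c m / m.+1%:R)) =
    \sum_(m < N) (fun s => s ^+ m.+1 * (c m / m.+1%:R)).
  by apply/funext => x; rewrite fct_sumE.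
by apply: is_derive_sum => m; exact: is_derive_monomial.
Qed.

Section path.
Variable w : R[i].
Hypothesis w1 : normc w < 1.

(** The squared modulus of [1 - s%:C * w]. The [0] in [0 - s * complex.Im w] gives both coordinates
    the shape treated by [is_derive_affine]. *)
Let q s := (1 - s * complex.Re w) ^+ 2 + (0 - s * complex.Im w) ^+ 2.

Lemma Re_1Br_gt0 s : 0 <= s -> s <= 1 -> 0 < 1 - s * complex.Re w.
Proof.
move=> s0 s1; rewrite subr_gt0 (le_lt_trans _ w1)//.
rewrite (le_trans (ler_norm _))// normrM (ger0_norm s0).
by rewrite (le_trans _ (Re_le_normc _))// ler_piMl.
Qed.

Let q_gt0 s : 0 <= s -> s <= 1 -> 0 < q s.
Proof. by move=> s0 s1; rewrite /q ltr_wpDr ?sqr_ge0// exprn_gt0// Re_1Br_gt0. Qed.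

Lemma Re_clog_path s : 0 <= s -> s <= 1 ->
  complex.Re (clog (1 - s%:C * w)) = 2^-1 * ln (q s).
Proof.
move=> s0 s1; rewrite /clog/= normcE ReCD ImCD ReCN ImCN Re_realM Im_realM /=.
by rewrite -/(q s) -powR12_sqrt ?ltW ?q_gt0// ln_powR.
Qed.

Lemma Im_clog_path s : 0 <= s -> s <= 1 ->
  complex.Im (clog (1 - s%:C * w)) =
    atan ((0 - s * complex.Im w) / (1 - s * complex.Re w)).
Proof.
move=> s0 s1; rewrite /clog/= carg_atan;
  rewrite ?ReCD ?ImCD ?ReCN ?ImCN ?Re_realM ?Im_realM //=.
exact: Re_1Br_gt0.
Qed.

(** Here and in [is_derive_Im_clog_path]: the two coordinates of the derivative [- w / (1 - s w)] of
    [log (1 - s w)] in the real variable [s]. *)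
Lemma is_derive_Re_clog_path s : 0 <= s -> s <= 1 ->
  is_derive s 1 (fun s => 2^-1 * ln (q s)) (complex.Re (- w / (1 - s%:C * w))).
Proof.
move=> s0 s1.
have d1 := is_derive_affine (complex.Re w) 1 s.
have d2 := is_derive_affine (complex.Im w) 0 s.
have dq : is_derive s 1 q
    ((2%:R * (1 - s * complex.Re w)) * (- complex.Re w) +
     (2%:R * (0 - s * complex.Im w)) * (- complex.Im w)).
  have -> : q = (fun s => 1 - s * complex.Re w) ^+ 2 + (fun s => 0 - s * complex.Im w) ^+ 2.
    by apply/funext => x; rewrite fctE !exprfctE.
  by apply: is_derive_eq.
have dl := is_derive1_ln (q_gt0 s0 s1).
have dc := is_derive1_comp dl dq.
have -> : (fun s => 2^-1 * ln (q s)) = 2^-1 *: (@ln R \o q) by [].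
apply: is_derive_eq.
rewrite Re_divC !(ReCD, ImCD, ReCN, ImCN, Re_realM, Im_realM) /= /GRing.scale/= -/(q s).
have := q_gt0 s0 s1; rewrite /q; set D := (_ ^+ 2 + _) => q0.
by field; rewrite gt_eqF.
Qed.

Lemma is_derive_Im_clog_path s : 0 <= s -> s <= 1 ->
  is_derive s 1 (fun s => atan ((0 - s * complex.Im w) / (1 - s * complex.Re w)))
    (complex.Im (- w / (1 - s%:C * w))).
Proof.
move=> s0 s1.
have d1 := is_derive_affine (complex.Re w) 1 s.
have d2 := is_derive_affine (complex.Im w) 0 s.
have p0 := Re_1Br_gt0 s0 s1.
have dv : is_derive s 1 (fun s => (1 - s * complex.Re w)^-1)
    (complex.Re w / (1 - s * complex.Re w) ^+ 2).
  apply: is_derive_eq; first by apply: is_deriveV; rewrite gt_eqF.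
  by rewrite /GRing.scale/=; field; rewrite gt_eqF.
have dq : is_derive s 1
    (fun s => (0 - s * complex.Im w) / (1 - s * complex.Re w))
    (- complex.Im w / (1 - s * complex.Re w) ^+ 2).
  have dm := is_deriveM d2 dv.
  by apply: (is_derive_eq dm); rewrite /GRing.scale/=; field; rewrite gt_eqF.
have dc := is_derive1_comp (is_derive1_atan _) dq.
apply: (is_derive_eq dc).
rewrite Im_divC !(ReCD, ImCD, ReCN, ImCN, Re_realM, Im_realM) /= /GRing.scale/=.
have := q_gt0 s0 s1; rewrite /q.
rewrite [X in _ -> _ = X / _](_ : _ = - complex.Im w); last by ring.
set p := 1 - _ in p0 *; set m := 0 - _ => q0.
by field; rewrite !gt_eqF//= addrC.
Qed.

(** The remainder of the geometric expansion of [- w / (1 - s%:C * w)] cut after [N] terms. *)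
Let tail s N := - w * (s%:C * w) ^+ N / (1 - s%:C * w).

Lemma tailE s N : 0 <= s -> s <= 1 ->
  - w / (1 - s%:C * w) + \sum_(m < N) (s ^+ m)%:C * w ^+ m.+1 = tail s N.
Proof.
move=> s0 s1; have h : 1 - s%:C * w != 0.
  apply/eqP => h; have := Re_1Br_gt0 s0 s1.
  by have := congr1 (@complex.Re R) h; rewrite ReCD ReCN Re_realM /= => ->; rewrite ltxx.
have -> : \sum_(m < N) (s ^+ m)%:C * w ^+ m.+1 = w * \sum_(m < N) (s%:C * w) ^+ m.
  rewrite mulr_sumr; apply: eq_bigr => m _.
  by rewrite rmorphXn/= exprMn exprS mulrCA.
apply: (mulIf h); rewrite mulrDl !divfK//.
rewrite -mulrA [X in _ + _ * X]mulrC -opprB mulNr -subrX1.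
by rewrite opprB mulrBr mulr1 addrC mulNr; ring.
Qed.

(** Uniform in [s], because the mean value theorem does not tell at which point the derivative is
    taken. *)
Lemma normc_tail s N : 0 <= s -> s <= 1 ->
  normc (tail s N) <= normc w ^+ N / (1 - normc w).
Proof.
move=> s0 s1; rewrite /tail !Normc.normcM Normc.normcV complex.normcN normcX Normc.normcM.
rewrite normc_real (ger0_norm s0).
have w0 := normc_ge0 w.
have h : 1 - normc w <= normc (1 - s%:C * w).
  rewrite lerBlDr -[leLHS]normr1 -normc_real.
  have -> : 1%:C = (1 - s%:C * w) + s%:C * w by rewrite subrK.
  rewrite (le_trans (complex.le_normcD _ _))// lerD2l.
  by rewrite Normc.normcM normc_real (ger0_norm s0) ler_piMl.
rewrite ler_pM//.
- by rewrite mulr_ge0// exprn_ge0// mulr_ge0.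
- by rewrite invr_ge0 (le_trans _ h)// subr_ge0 ltW.
- rewrite -[leRHS]mul1r ler_pM//.
  + by rewrite exprn_ge0// mulr_ge0.
  + exact: ltW.
  + by rewrite lerXn2r ?nnegrE ?mulr_ge0// ler_piMl.
- by rewrite lef_pV2// posrE ?subr_gt0// (lt_le_trans _ h)// subr_gt0.
Qed.

(** Along [s] in [[0, 1]], the logarithm [log (1 - s w)] plus its partial sum vanishes at [0] and
    has derivative [tail s N]. The mean value theorem holds for real functions only, so it is
    applied to each coordinate, whence the factor 2. *)
Lemma clog_partial_bound N :
  normc (clog (1 - w) + \sum_(m < N) w ^+ m.+1 / m.+1%:R) <=
  2%:R * (normc w ^+ N / (1 - normc w)).
Proof.
have key (f : R -> R) (df : R -> R) (c : nat -> R) :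
    (forall s, 0 <= s -> s <= 1 -> is_derive s 1 f (df s)) ->
    f 0 = 0 ->
    (forall s, 0 <= s -> s <= 1 ->
      `|df s + \sum_(m < N) s ^+ m * c m| <= normc w ^+ N / (1 - normc w)) ->
    `|f 1 + \sum_(m < N) c m / m.+1%:R| <= normc w ^+ N / (1 - normc w).
  move=> hf f0 hb.
  pose F s := f s + \sum_(m < N) s ^+ m.+1 * (c m / m.+1%:R).
  have dF s : 0 <= s -> s <= 1 -> is_derive s 1 F (df s + \sum_(m < N) s ^+ m * c m).
    move=> s0 s1; have h1 := hf s s0 s1; have h2 := is_derive_power_sum c N s.
    exact: (@is_deriveD _ _ _ f _ s 1 _ _ h1 h2).
  have [||k] := @MVT R F (fun s => df s + \sum_(m < N) s ^+ m * c m) 0 1 ltr01.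
  - by move=> s /[!in_itv]/= /andP[s0 s1]; apply: dF; exact: ltW.
  - apply: derivable_within_continuous => s /[!in_itv]/= /andP[s0 s1].
    by have [] := dF s s0 s1.
  move=> /[!in_itv]/= /andP[k0 k1]; rewrite subr0 mulr1 {1 2}/F f0 add0r.
  rewrite [X in _ - X]big1; last by move=> m _; rewrite exprS mul0r mul0r.
  rewrite subr0; under [X in f 1 + X]eq_bigr do rewrite expr1n mul1r.
  by move=> ->; rewrite hb// ltW.
rewrite (le_trans (normc_le_ReIm _))// mulr_natl mulr2n lerD//.
- rewrite ReCD Re_sum.
  have -> : complex.Re (clog (1 - w)) = 2^-1 * ln (q 1).
    by rewrite -Re_clog_path// mul1r.
  under eq_bigr do rewrite natrC -fmorphV mulrC Re_realM mulrC.
  apply: (key _ _ (fun m => complex.Re (w ^+ m.+1)) is_derive_Re_clog_path).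
    by rewrite /q !mul0r !subr0 expr1n expr0n addr0 ln1 mulr0.
  move=> s s0 s1; under eq_bigr do rewrite -Re_realM.
  rewrite -Re_sum -ReCD tailE//.
  by rewrite (le_trans (Re_le_normc _))// normc_tail.
- rewrite ImCD Im_sum.
  rewrite -[w in clog (1 - w)]mul1r Im_clog_path//.
  under eq_bigr do rewrite natrC -fmorphV mulrC Im_realM mulrC.
  apply: (key _ _ (fun m => complex.Im (w ^+ m.+1)) is_derive_Im_clog_path).
    by rewrite !mul0r !subr0 mul0r atan0.
  move=> s s0 s1; under eq_bigr do rewrite -Im_realM.
  rewrite -Im_sum -ImCD tailE//.
  by rewrite (le_trans (Im_le_normc _))// normc_tail.
Qed.

Lemma cvgc_clog :
  cvgc (fun N => \sum_(m < N) w ^+ m.+1 / m.+1%:R) (- clog (1 - w)).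
Proof.
apply: (@cvgc_le _ _ _ (fun N => 2%:R * (normc w ^+ N / (1 - normc w)))).
  by move=> N; rewrite opprK addrC clog_partial_bound.
rewrite -(mulr0 2%:R) -[X in 2%:R * X](mul0r (1 - normc w)^-1).
apply: cvgMr; apply: cvgMl; apply: cvg_expr.
by rewrite ger0_norm ?normc_ge0.
Qed.

End path.
End LogSeries.

(** * Euler integrals *)

Section LogSubstitution.
Variable R : realType.
Implicit Types (a e d u t : R) (G : R -> R).
Local Notation mu := (@lebesgue_measure R).

Lemma open_continuous_measurable_funS (U D : set R) (f : R -> R) :
  open U -> D `<=` U -> {in U, continuous f} -> measurable_fun D f.
Proof.
move=> oU DU cf; have mf := open_continuous_measurable_fun oU cf.
by apply: (measurable_funS _ DU mf); exact: open_measurable.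
Qed.

Lemma is_derive_Mln a t : 0 < t ->
  is_derive t 1 (fun t => - (a * ln t)) (- (a / t)).
Proof.
move=> t0; have h := is_derive1_ln t0.
have -> : (fun t => - (a * ln t)) = - (a *: @ln R) by [].
by apply: is_derive_eq.
Qed.

Lemma cvg_derive_Mln a t : 0 < t ->
  derive1 (fun t => - (a * ln t)) u @[u --> t] --> - (a / t).
Proof.
move=> t0; apply: cvg_trans.
  apply: (@near_eq_cvg _ _ _ _ (fun t => - (a / t))).
  near=> u; rewrite derive1E; have u0 : 0 < u by near: u; exact: lt_nbhsr.
  by have h := is_derive_Mln a u0; rewrite derive_val.
apply: cvgN; apply: cvgMr; apply: cvgV; rewrite ?gt_eqF//; exact: cvg_id.
Unshelve. all: by end_near. Qed.

(** A compact segment inside []0, 1[] avoids both [t = 0], where the logarithm is singular, and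
    [t = 1], which corresponds to [u = 0], where [G] may be singular. *)
Lemma integral_Mln_segment a e d G : 0 < a -> 0 < e -> e <= d -> d < 1 ->
  (forall u, 0 < u -> {for u, continuous G}) ->
  (\int[mu]_(u in `[(- (a * ln d))%R, (- (a * ln e))%R]) (G u)%:E =
  \int[mu]_(t in `[e, d]) (G (- (a * ln t)) * (a / t))%R%:E)%E.
Proof.
move=> a0 e0 ed d1 cG.
have d0 := lt_le_trans e0 ed.
have pos t : t \in `[e, d] -> 0 < t.
  by rewrite in_itv/= => /andP[et _]; exact: lt_le_trans et.
have Fcont t : 0 < t -> - (a * ln u) @[u --> t] --> - (a * ln t).
  by move=> t0; apply: cvgN; apply: cvgMr; exact: continuous_ln.
rewrite (@integration_by_substitution_decreasing R (fun t => - (a * ln t)) G e d)//.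
- apply: eq_integral => t /[!inE]/= /pos t0; congr EFin.
  rewrite !fctE; congr (_ * _).
  by have h := is_derive_Mln a t0; rewrite derive1E derive_val opprK.
- move=> x y /pos x0 /pos y0 xy /=.
  by rewrite ltrN2 ltr_pM2l// ltr_ln.
- move=> t /subset_itv_oo_cc /pos t0; rewrite /continuous_at.
  have h := is_derive_Mln a t0; rewrite derive1E derive_val.
  exact: cvg_derive_Mln.
- by apply/cvg_ex; exists (- (a / e)); apply: cvg_at_right_filter; exact: cvg_derive_Mln.
- by apply/cvg_ex; exists (- (a / d)); apply: cvg_at_left_filter; exact: cvg_derive_Mln.
- split.
  + by move=> t /subset_itv_oo_cc /pos t0; have [] := is_derive_Mln a t0.
  + by apply: cvg_at_right_filter; exact: Fcont.
  + by apply: cvg_at_left_filter; exact: Fcont.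
- apply: continuous_in_subspaceT => u /[!inE]/= /[!in_itv]/= /andP[du _].
  apply: cG; rewrite (lt_le_trans _ du)// oppr_gt0 pmulr_rlt0//.
  by rewrite ln_lt0// d0.
Qed.

(** Monotone convergence along segments exhausting []0, 1[]; their images exhaust the half-line. *)
Lemma ge0_integral_Mln a G : 0 < a ->
  (forall u, 0 < u -> {for u, continuous G}) ->
  (forall u, 0 < u -> 0 <= G u) ->
  (\int[mu]_(u in `]0%R, +oo[) (G u)%:E =
  \int[mu]_(t in `]0%R, 1%R[) (G (- (a * ln t)) * (a / t))%R%:E)%E.
Proof.
move=> a0 cG G0.
(* The shift by 2 gives [e n <= 1/2], so that the segment from [e n] to [1 - e n] is never empty. *)
pose e (n : nat) : R := n.+2%:R^-1.
have e0 n : 0 < e n by rewrite invr_gt0.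
have e1 n : e n <= 2^-1 by rewrite lef_pV2 ?posrE// ler_nat.
have le_e m n : (m <= n)%N -> e n <= e m.
  by move=> mn; rewrite lef_pV2 ?posrE// ler_nat.
have ed n : e n <= 1 - e n by have := e1 n; lra.
have d1 n : 1 - e n < 1 by have := e0 n; lra.
have d0 n : 0 < 1 - e n by exact: lt_le_trans (e0 n) (ed n).
have e_to0 : e n @[n --> \oo] --> 0.
  by rewrite (cvg_shiftS (@harmonic R)); exact: cvg_harmonic.
pose A n := [set` `[e n, 1 - e n]]; pose F t := - (a * ln t).
pose B n := [set` `[F (1 - e n), F (e n)]].
have seg n := @integral_Mln_segment a (e n) (1 - e n) G a0 (e0 n) (ed n) (d1 n) cG.
have AE : \bigcup_n A n = [set` `]0, 1[].
  apply/seteqP; split => [t [n _]|t]; rewrite /A/= !in_itv/=.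
    by move=> /andP[et td]; rewrite (lt_le_trans (e0 n) et) (le_lt_trans td).
  move=> /andP[t0 t1]; have m0 : 0 < Num.min t (1 - t) by rewrite lt_min t0 subr_gt0.
  move/cvgrPdist_lt: e_to0 => /(_ _ m0)[n _ /(_ n)]/=; rewrite leqnn => /(_ isT).
  rewrite sub0r normrN gtr0_norm// lt_min => /andP[h1 h2]; exists n => //=.
  by rewrite in_itv/=; lra.
have Fpos t : 0 < t -> t < 1 -> 0 < F t.
  by move=> t0 t1; rewrite oppr_gt0 pmulr_rlt0// ln_lt0// t0.
have Finv u : u = F (expR (- (u / a))).
  by rewrite /F expRK mulrN opprK mulrCA divff ?mulr1// gt_eqF.
have BE : \bigcup_n B n = [set` `]0, +oo[].
  apply/seteqP; split => [u [n _]|u]; rewrite /B/= !in_itv/= ?andbT.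
    by move=> /andP[+ _]; apply: lt_le_trans; rewrite Fpos.
  move=> u0; have : (\bigcup_n A n) (expR (- (u / a))).
    by rewrite AE/= in_itv/= expR_gt0 expR_lt1 oppr_lt0 divr_gt0.
  move=> [n _]; rewrite /A/= in_itv/= => /andP[h1 h2]; exists n => //=.
  rewrite in_itv/= [u]Finv /F !lerN2 !ler_pM2l// !ler_ln ?posrE ?expR_gt0//.
  by rewrite h1 h2.
have posB n u : B n u -> 0 < u.
  by rewrite /B/= in_itv/= => /andP[+ _]; apply: lt_le_trans; rewrite Fpos.
have posA n t : A n t -> 0 < t /\ t < 1.
  rewrite /A/= in_itv/= => /andP[et td].
  by rewrite (lt_le_trans (e0 n) et) (le_lt_trans td).
have h1 : (\int[mu]_(u in B n) (G u)%:E)%E @[n --> \oo] -->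
    (\int[mu]_(u in `]0%R, +oo[) (G u)%:E)%E.
  rewrite -BE; apply: ge0_nondecreasing_set_cvg_integral.
  - move=> m n mn; rewrite subsetEset => u; rewrite /B/= !in_itv/= => /andP[hu1 hu2].
    apply/andP; split; [apply: le_trans hu1|apply: (le_trans hu2)];
      rewrite /F lerN2 ler_pM2l// ler_ln ?posrE// ?le_e//.
    by rewrite lerB// le_e.
  - by move=> n; exact: measurable_itv.
  - move=> n; apply/measurable_EFinP.
    apply: (@open_continuous_measurable_funS [set` `]0, +oo[]).
    - exact: interval_open.
    - by move=> u /posB u0; rewrite /= in_itv/= u0.
    - by move=> u /[!inE]/= /[!in_itv]/= /andP[u0 _]; exact: cG.
  - by move=> n u /posB u0; rewrite lee_fin G0.
have h2 : (\int[mu]_(t in A n) (G (F t) * (a / t))%R%:E)%E @[n --> \oo] -->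
    (\int[mu]_(t in `]0%R, 1%R[) (G (F t) * (a / t))%R%:E)%E.
  rewrite -AE; apply: ge0_nondecreasing_set_cvg_integral.
  - move=> m n mn; rewrite subsetEset => u; rewrite /A/= !in_itv/= => /andP[hu1 hu2].
    by have := le_e _ _ mn; lra.
  - by move=> n; exact: measurable_itv.
  - move=> n; apply/measurable_EFinP.
    apply: (@open_continuous_measurable_funS [set` `]0, 1[]).
    - exact: interval_open.
    - by move=> u /posA [u0 u1]; rewrite /= in_itv/= u0.
    - move=> t /[!inE]/= /[!in_itv]/= /andP[t0 t1].
    apply: cvgM.
      apply: (@cvg_comp _ _ _ F G _ (nbhs (F t))); last exact: cG (Fpos _ t0 t1).
      by apply: cvgN; apply: cvgMr; exact: continuous_ln.
    by apply: cvgMr; apply: cvgV; rewrite ?gt_eqF//; exact: cvg_id.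
  - move=> n u /posA [u0 u1]; rewrite lee_fin mulr_ge0// ?G0 ?Fpos//.
    by rewrite divr_ge0// ltW.
have {}h2 : (\int[mu]_(u in B n) (G u)%:E)%E @[n --> \oo] -->
    (\int[mu]_(t in `]0%R, 1%R[) (G (F t) * (a / t))%R%:E)%E.
  apply: cvg_trans h2; apply: near_eq_cvg; apply: nearW => n.
  by rewrite seg.
by have := cvg_unique _ h1 h2; apply.
Qed.

(** The integral is by definition the difference of those of the positive and negative parts, and
    these agree one by one by the nonnegative case. *)
Lemma integral_Mln a G : 0 < a ->
  (forall u, 0 < u -> {for u, continuous G}) ->
  (\int[mu]_(u in `]0%R, +oo[) (G u)%:E =
  \int[mu]_(t in `]0%R, 1%R[) (G (- (a * ln t)) * (a / t))%R%:E)%E.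
Proof.
move=> a0 cG.
(* Writing the positive part as half of [|x| + x] makes its continuity evident and lets the
   nonnegative factor [a / t] be pulled out. *)
have posE (x : R) : maxe x%:E 0%E = (2^-1 * (`|x| + x))%:E.
  rewrite -EFin_max; congr EFin; case: (leP 0 x) => x0.
    by rewrite ger0_norm//; lra.
  by rewrite ltr0_norm//; lra.
have cpos (H : R -> R) : (forall u, 0 < u -> {for u, continuous H}) ->
    forall u, 0 < u -> {for u, continuous (fun u => 2^-1 * (`|H u| + H u))}.
  move=> cH u u0; apply: cvgMr; apply: cvgD; last exact: cH.
  by apply: cvg_norm; exact: cH.
have pos_ge0 (x : R) : 0 <= 2^-1 * (`|x| + x).
  by rewrite mulr_ge0// -lerBlDr sub0r -normrN ler_norm.
have key (H : R -> R) (cH : forall u, 0 < u -> {for u, continuous H}) :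
    (\int[mu]_(u in `]0%R, +oo[) maxe (H u)%:E 0 =
    \int[mu]_(t in `]0%R, 1%R[) maxe (H (- (a * ln t)) * (a / t))%R%:E 0)%E.
  under eq_integral do rewrite posE.
  rewrite (ge0_integral_Mln a0 (cpos _ cH)); last by move=> u _; exact: pos_ge0.
  apply: eq_integral => t /[!inE]/=.
  rewrite in_itv/= => /andP[t0 t1]; rewrite posE; congr EFin.
  rewrite normrM [X in _ * (_ * X + _)]ger0_norm; last by rewrite divr_ge0// ltW.
  by ring.
rewrite integralE [RHS]integralE.
congr (_ - _)%E.
  under eq_integral do rewrite funeposE.
  by under [RHS]eq_integral do rewrite funeposE; exact: key.
under eq_integral do rewrite funenegE -EFinN.
rewrite (key (fun u => - G u)); last by move=> u u0; apply: cvgN; exact: cG.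
by apply: eq_integral => t _; rewrite funenegE -EFinN mulNr.
Qed.

End LogSubstitution.

(** * Integrability of the real Euler kernels *)

Section EulerIntegrals.
Variable R : realType.
Implicit Types (a s t u : R) (z : R[i]).
Local Notation mu := (@lebesgue_measure R).

Lemma ge0_integrable (D : set R) (f : R -> R) : measurable D ->
  measurable_fun D f -> (forall x, D x -> 0 <= f x) ->
  (\int[mu]_(x in D) (f x)%:E < +oo)%E -> mu.-integrable D (EFin \o f).
Proof.
move=> mD mf f0 fy; apply/integrableP; split; first exact/measurable_EFinP.
by under eq_integral => x /[!inE] Dx do rewrite /= ger0_norm ?f0//.
Qed.

Lemma continuous_powR_pos s u : 0 < u -> {for u, continuous (fun u => u `^ s)}.
Proof.
move=> u0; have h := is_derive1_powR s u0.
by apply: differentiable_continuous; apply/derivable1_diffP; case: h.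
Qed.

Lemma continuous_expRMl s : continuous (fun u => expR (s * u)).
Proof.
move=> u; apply: (@cvg_comp _ _ _ (fun u => s * u) expR _ (nbhs (s * u))).
  by apply: cvgMr; exact: cvg_id.
exact: continuous_expR.
Qed.

(** Substituting [u = - ln t / s] turns the integrand into the constant [s^-1] on []0, 1[]. *)
Lemma integral_expRN s : 0 < s ->
  (\int[mu]_(u in `]0%R, +oo[) (expR (- s * u))%:E = (s^-1)%:E)%E.
Proof.
move=> s0; have si0 : 0 < s^-1 by rewrite invr_gt0.
rewrite (ge0_integral_Mln si0); last 2 first.
- by move=> u u0; exact: continuous_expRMl.
- by move=> u u0; exact: expR_ge0.
transitivity (\int[mu]_(t in `]0%R, 1%R[) (s^-1)%:E)%E; last first.
  by rewrite integral_cst//= lebesgue_measure_itv/= lte_fin ltr01 -EFinB subr0 mule1.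
apply: eq_integral => t /[!inE]/= /[!in_itv]/= /andP[t0 t1]; congr EFin.
by rewrite mulrNN mulVKf ?gt_eqF// lnK ?posrE// mulrCA divff ?gt_eqF// mulr1.
Qed.

Lemma integrable_expRN s : 0 < s ->
  mu.-integrable `]0, +oo[ (EFin \o (fun u => expR (- s * u))).
Proof.
move=> s0; apply: ge0_integrable => //.
- apply: (@open_continuous_measurable_funS _ setT); [exact: openT|by []|].
  by move=> u _; exact: continuous_expRMl.
- by rewrite integral_expRN// ltry.
Qed.

Lemma measurable_powR_pos (D : set R) s : D `<=` [set` `]0, +oo[] ->
  measurable_fun D (fun u => u `^ s).
Proof.
move=> Dpos; apply: open_continuous_measurable_funS Dpos _; first exact: interval_open.
by move=> u /[!inE]/= /[!in_itv]/= /andP[u0 _]; exact: continuous_powR_pos.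
Qed.

(** The power is the image of [e^(-s u)] under [u = - ln t], so its integral is again [s^-1]. *)
Lemma integrable_powR01 s : 0 < s ->
  mu.-integrable `]0, 1[ (EFin \o (fun u => u `^ (s - 1))).
Proof.
move=> s0; apply: ge0_integrable => //.
- apply: measurable_powR_pos => u /=; rewrite !in_itv/= andbT.
  by move=> /andP[].
- by move=> u _; exact: powR_ge0.
suff -> : (\int[mu]_(u in `]0%R, 1%R[) (u `^ (s - 1))%:E = (s^-1)%:E)%E by rewrite ltry.
rewrite -(integral_expRN s0) (ge0_integral_Mln ltr01); last 2 first.
- by move=> u u0; exact: continuous_expRMl.
- by move=> u u0; exact: expR_ge0.
apply: eq_integral => t /[!inE]/= /[!in_itv]/= /andP[t0 t1]; congr EFin.
rewrite mul1r mulrNN powRB; last by rewrite (gt_eqF t0) implybT.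
by rewrite powRr1 ?ltW// /powR gt_eqF// mul1r.
Qed.

Definition gamma_kernel s u := u `^ (s - 1) * expR (- u).

Lemma gamma_kernel_ge0 s u : 0 <= gamma_kernel s u.
Proof. by rewrite mulr_ge0 ?powR_ge0 ?expR_ge0. Qed.

Lemma continuous_gamma_kernel s u : 0 < u -> {for u, continuous (gamma_kernel s)}.
Proof.
move=> u0; apply: cvgM; first exact: continuous_powR_pos.
have -> : (fun x => expR (- x)) = (fun u : R => expR (- 1 * u)).
  by apply/funext => x; rewrite mulN1r.
by rewrite -[in X in _ --> X]mulN1r; exact: continuous_expRMl.
Qed.

Lemma measurable_gamma_kernel s : measurable_fun (`]0, +oo[%classic : set R) (gamma_kernel s).
Proof.
apply: (@open_continuous_measurable_funS _ [set` `]0, +oo[]) => //.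
by move=> u /[!inE]/= /[!in_itv]/= /andP[u0 _]; exact: continuous_gamma_kernel.
Qed.

Lemma integrable_gamma_kernel s : 0 < s ->
  mu.-integrable `]0, +oo[ (EFin \o gamma_kernel s).
Proof.
move=> s0.
(* Raising [v <= e^v] at [v = u / (2 s)] to the power [s] gives [u^s <= C e^(u/2)]: half of the
   decay of [e^(-u)] absorbs the power. This is used for [u >= 1]; below 1 the power itself is the
   majorant. *)
pose C := (2%:R * s) `^ s.
have C0 : 0 <= C by exact: powR_ge0.
have h1 : mu.-integrable `]0, +oo[
    ((EFin \o (fun u => u `^ (s - 1))) \_ [set` `]0, 1[]).
  apply/integrable_restrict => //; rewrite setIidr; first exact: integrable_powR01.
  by move=> u /=; rewrite !in_itv/= andbT => /andP[].
have half0 : 0 < 2^-1 :> R by rewrite invr_gt0.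
have h2 : mu.-integrable `]0, +oo[
    (fun u => C%:E * (EFin \o (fun u => expR (- 2^-1 * u))) u)%E.
  by apply: integrableZl => //; exact: integrable_expRN.
have h3 : mu.-integrable `]0, +oo[
    ((EFin \o (fun u => (u `^ (s - 1))%R)) \_ [set` `]0%R, 1%R[] \+
      (fun u => C%:E * (EFin \o (fun u => expR (- 2^-1 * u)%R)) u))%E.
  exact: integrableD.
apply: (le_integrable _ _ _ h3) => //.
  by apply/measurable_EFinP; exact: measurable_gamma_kernel.
move=> u /=; rewrite in_itv/= andbT => u0.
rewrite ger0_norm ?gamma_kernel_ge0//.
apply: le_trans (lee_abs _); rewrite patchE; case: ifPn => [|].
  rewrite inE/= in_itv/= => /andP[_ u1] /=.
  rewrite -EFinM -EFinD lee_fin (@le_trans _ _ (u `^ (s - 1)))//.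
    by rewrite /gamma_kernel ler_piMr ?powR_ge0// expR_le1 oppr_le0 ltW.
  by rewrite lerDl mulr_ge0 ?expR_ge0.
rewrite notin_setE/= in_itv/= u0/= => /negP; rewrite -leNgt => u1.
rewrite add0e -EFinM lee_fin.
have -> : expR (- 2^-1 * u) = expR (u / 2%:R) * expR (- u).
  by rewrite -expRD; congr expR; field.
rewrite /gamma_kernel mulrA ler_wpM2r ?expR_ge0//.
rewrite (@le_trans _ _ (u `^ s))//; first by rewrite ler_powR// gerBl.
have -> : u = (2%:R * s) * (u / (2%:R * s)) by field; rewrite gt_eqF.
rewrite powRM ?divr_ge0 ?mulr_ge0 ?(ltW s0) ?(ltW u0)// ler_wpM2l//.
rewrite [X in _ <= expR X](_ : _ = u / (2%:R * s) * s); last by field; rewrite gt_eqF.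
rewrite expRM ge0_ler_powR ?nnegrE ?(ltW s0) ?expR_ge0 ?divr_ge0 ?mulr_ge0 ?(ltW s0) ?(ltW u0)//.
by rewrite (le_trans _ (expR_ge1Dx _))// lerDr.
Qed.

(** The integrand [u^(s-1) e^(-a u)] transported to []0, 1[] by [u = - ln t]; its integral is
    [Gamma(s) a^(-s)]. *)
Definition mellin_kernel s a t := (- ln t) `^ (s - 1) * t `^ (a - 1).

Lemma mellin_kernel_ge0 s a t : 0 <= mellin_kernel s a t.
Proof. by rewrite mulr_ge0 ?powR_ge0. Qed.

Lemma gamma_kernel_Mln s a t : 0 < a -> 0 < t -> t < 1 ->
  gamma_kernel s (- (a * ln t)) * (a / t) = a `^ s * mellin_kernel s a t.
Proof.
move=> a0 t0 t1; have L0 : 0 < - ln t by rewrite oppr_gt0 ln_lt0// t0.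
rewrite /gamma_kernel /mellin_kernel -mulrN powRM ?ltW// mulrN opprK.
have -> : expR (a * ln t) = t `^ a by rewrite /powR gt_eqF.
rewrite (@powRB _ a s 1) ?(gt_eqF a0) ?implybT//.
rewrite (@powRB _ t a 1) ?(gt_eqF t0) ?implybT// !powRr1 ?ltW//.
by field; rewrite !gt_eqF.
Qed.

Lemma integrable_mellin_kernel s a : 0 < s -> 0 < a ->
  mu.-integrable `]0, 1[ (EFin \o mellin_kernel s a).
Proof.
move=> s0 a0.
have as0 : a `^ s != 0 by rewrite gt_eqF// powR_gt0.
have h : mu.-integrable `]0, 1[ (EFin \o (fun t => gamma_kernel s (- (a * ln t)) * (a / t))).
  have Fpos t : 0 < t -> t < 1 -> 0 < - (a * ln t).
    by move=> t0 t1; rewrite oppr_gt0 pmulr_rlt0// ln_lt0// t0.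
  apply: ge0_integrable => //.
  - apply: (@open_continuous_measurable_funS _ [set` `]0, 1[]) => //.
    move=> t /[!inE]/= /[!in_itv]/= /andP[t0 t1]; apply: cvgM.
      apply: (@cvg_comp _ _ _ (fun t => - (a * ln t)) (gamma_kernel s) _ (nbhs (- (a * ln t)))).
        by apply: cvgN; apply: cvgMr; exact: continuous_ln.
      by apply: continuous_gamma_kernel; exact: Fpos.
    by apply: cvgMr; apply: cvgV; rewrite ?gt_eqF//; exact: cvg_id.
  - move=> t /=; rewrite in_itv/= => /andP[t0 t1].
    by rewrite mulr_ge0 ?gamma_kernel_ge0 ?divr_ge0 ?ltW.
  rewrite -ge0_integral_Mln//.
  - have /integrableP[_] := integrable_gamma_kernel s0.
    by under eq_integral do rewrite /= ger0_norm ?gamma_kernel_ge0//.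
  - by move=> u u0; exact: continuous_gamma_kernel.
  - by move=> u u0; exact: gamma_kernel_ge0.
have {}h := integrableZl _ (a `^ s)^-1 h.
apply: (eq_integrable _ _ _ _ (h _)) => //.
move=> t /[!inE]/= /[!in_itv]/= /andP[t0 t1] /=.
by rewrite gamma_kernel_Mln// -EFinM mulKf.
Qed.

End EulerIntegrals.

(** * Integration of complex functions by coordinates *)

Section ComplexIntegrals.
Variable R : realType.
Local Notation mR := (measurableTypeR R).
Implicit Types (D : set mR) (f : R -> R[i]) (c : R[i]).
Local Notation mu := (@lebesgue_measure R).
Local Notation normc := (@Normc.normc R).

Definition cmeasurable D f :=
  measurable_fun D (fun t => complex.Re (f t)) /\
  measurable_fun D (fun t => complex.Im (f t)).

Definition cintegrable D f :=
  mu.-integrable D (EFin \o (fun t => complex.Re (f t))) /\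
  mu.-integrable D (EFin \o (fun t => complex.Im (f t))).

Lemma cintegrable_measurable D f : cintegrable D f -> cmeasurable D f.
Proof.
by move=> [/integrableP[/measurable_EFinP ? _] /integrableP[/measurable_EFinP ? _]].
Qed.

Lemma cintegrable_le D f (g : R -> R) : measurable D -> cmeasurable D f ->
  mu.-integrable D (EFin \o g) -> (forall t, D t -> normc (f t) <= g t) ->
  cintegrable D f.
Proof.
move=> mD [mr mi] ig fg; split; apply: (le_integrable mD _ _ ig);
  (try exact/measurable_EFinP) => t Dt /=;
  rewrite lee_fin (le_trans _ (ler_norm _))// (le_trans _ (fg _ Dt))//.
- exact: Re_le_normc.
- exact: Im_le_normc.
Qed.

Lemma eq_cintegral D f g : (forall t, D t -> f t = g t) ->
  cintegral D f = cintegral D g.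
Proof.
move=> fg; rewrite /cintegral; congr Complex;
  by apply: eq_Rintegral => t /[!inE] Dt; rewrite fg.
Qed.

Lemma eq_cintegrable D f g : measurable D -> (forall t, D t -> f t = g t) ->
  cintegrable D f -> cintegrable D g.
Proof.
move=> mD fg [h1 h2]; split.
  by apply: (eq_integrable mD _ _ _ h1) => t /[!inE] Dt /=; rewrite fg.
by apply: (eq_integrable mD _ _ _ h2) => t /[!inE] Dt /=; rewrite fg.
Qed.

Lemma cintegralD D f g : measurable D -> cintegrable D f -> cintegrable D g ->
  cintegral D (fun t => f t + g t) = cintegral D f + cintegral D g.
Proof.
move=> mD [f1 f2] [g1 g2]; rewrite /cintegral.
under eq_Rintegral do rewrite ReCD.
under [X in _ +i* X]eq_Rintegral do rewrite ImCD.
by rewrite !RintegralD.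
Qed.

Lemma cintegrableD D f g : measurable D -> cintegrable D f -> cintegrable D g ->
  cintegrable D (fun t => f t + g t).
Proof.
move=> mD [f1 f2] [g1 g2]; split.
  have := integrableD mD f1 g1; apply: eq_integrable => // t _ /=.
  by rewrite ReCD.
have := integrableD mD f2 g2; apply: eq_integrable => // t _ /=.
by rewrite ImCD.
Qed.

Lemma integrable_lincomb D (a b : R) (f g : R -> R) : measurable D ->
  mu.-integrable D (EFin \o f) -> mu.-integrable D (EFin \o g) ->
  mu.-integrable D (EFin \o (fun t => a * f t + b * g t)).
Proof.
move=> mD hf hg.
exact: (integrableD mD (integrableZl mD a hf) (integrableZl mD b hg)).
Qed.

Lemma Rintegral_lincomb D (a b : R) (f g : R -> R) : measurable D ->
  mu.-integrable D (EFin \o f) -> mu.-integrable D (EFin \o g) ->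
  \int[mu]_(t in D) (a * f t + b * g t) =
  a * \int[mu]_(t in D) f t + b * \int[mu]_(t in D) g t.
Proof.
move=> mD hf hg; rewrite RintegralD//.
- by rewrite !RintegralZl.
- exact: (integrableZl mD a hf).
- exact: (integrableZl mD b hg).
Qed.

Lemma cintegrableZ D c f : measurable D -> cintegrable D f ->
  cintegrable D (fun t => c * f t).
Proof.
move=> mD [f1 f2]; split.
  have := integrable_lincomb (complex.Re c) (- complex.Im c) mD f1 f2.
  apply: eq_integrable => // t _ /=; congr EFin.
  by rewrite ReCM mulNr.
have := integrable_lincomb (complex.Im c) (complex.Re c) mD f1 f2.
by apply: eq_integrable => // t _ /=; congr EFin; rewrite ImCM addrC.
Qed.

Lemma cintegralZ D c f : measurable D -> cintegrable D f ->
  cintegral D (fun t => c * f t) = c * cintegral D f.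
Proof.
move=> mD [f1 f2]; apply/eqP; rewrite eq_complex ReCM ImCM /=.
apply/andP; split; apply/eqP.
  rewrite -mulNr -Rintegral_lincomb//; apply: eq_Rintegral => t _.
  by rewrite ReCM mulNr.
rewrite addrC -Rintegral_lincomb//; apply: eq_Rintegral => t _.
by rewrite ImCM addrC.
Qed.

Lemma cintegrable_sum D (I : Type) (r : seq I) (F : I -> R -> R[i]) :
  measurable D -> (forall i, cintegrable D (F i)) ->
  cintegrable D (fun t => \sum_(i <- r) F i t).
Proof.
move=> mD iF; elim: r => [|i r ih].
  by split; apply: (eq_integrable mD _ _ _ (integrable0 mu D)) => t _;
    rewrite /= big_nil.
apply: (eq_cintegrable mD _ (cintegrableD mD (iF i) ih)) => t Dt.
by rewrite big_cons.
Qed.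

Lemma cintegral_sum D (I : Type) (r : seq I) (F : I -> R -> R[i]) :
  measurable D -> (forall i, cintegrable D (F i)) ->
  cintegral D (fun t => \sum_(i <- r) F i t) = \sum_(i <- r) cintegral D (F i).
Proof.
move=> mD iF; elim: r => [|i r ih].
  rewrite big_nil /cintegral; apply/eqP; rewrite eq_complex /=.
  by apply/andP; split; apply/eqP; under eq_Rintegral do rewrite big_nil;
    rewrite /Rintegral integral0.
rewrite big_cons -ih -cintegralD//; last exact: cintegrable_sum.
by apply: eq_cintegral => t Dt; rewrite big_cons.
Qed.

Lemma Rintegral_dominated D (f_ : nat -> R -> R) (f g : R -> R) :
  measurable D -> (forall n, measurable_fun D (f_ n)) ->
  (forall t, D t -> f_ n t @[n --> \oo] --> f t) ->
  mu.-integrable D (EFin \o g) ->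
  (forall n t, D t -> `|f_ n t| <= g t) ->
  mu.-integrable D (EFin \o f) /\
  \int[mu]_(t in D) f_ n t @[n --> \oo] --> \int[mu]_(t in D) f t.
Proof.
move=> mD mf cf ig fg.
have mlim : measurable_fun D f by apply: measurable_fun_cvg cf.
have [] := @dominated_convergence _ _ _ mu D mD (fun n => EFin \o f_ n) (EFin \o f) (EFin \o g).
- by move=> n; apply/measurable_EFinP.
- exact/measurable_EFinP.
- by apply: aeW => t Dt; apply: cvg_EFin; [exact: nearW|exact: cf].
- by [].
- by apply: aeW => t n Dt /=; rewrite lee_fin fg.
move=> intf _ h; split => //.
apply: fine_cvg; rewrite fineK//; exact: integrable_fin_num.
Qed.

Lemma cintegral_dominated D (f_ : nat -> R -> R[i]) f (g : R -> R) :
  measurable D -> (forall n, cmeasurable D (f_ n)) ->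
  (forall t, D t -> cvgc (f_ ^~ t) (f t)) ->
  mu.-integrable D (EFin \o g) ->
  (forall n t, D t -> normc (f_ n t) <= g t) ->
  cvgc (fun n => cintegral D (f_ n)) (cintegral D f).
Proof.
move=> mD mf cf ig fg; apply: cvgc_ReIm => /=.
  have [] // := @Rintegral_dominated D (fun n t => complex.Re (f_ n t))
    (fun t => complex.Re (f t)) g mD _ _ ig.
  - by move=> n; have [] := mf n.
  - by move=> t Dt; apply: (cvgc_Re (cf t Dt)).
  - by move=> n t Dt; rewrite (le_trans (Re_le_normc _))// fg.
have [] // := @Rintegral_dominated D (fun n t => complex.Im (f_ n t))
    (fun t => complex.Im (f t)) g mD _ _ ig.
- by move=> n; have [] := mf n.
- by move=> t Dt; apply: (cvgc_Im (cf t Dt)).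
- by move=> n t Dt; rewrite (le_trans (Im_le_normc _))// fg.
Qed.

End ComplexIntegrals.

(** * Euler's integral on the unit interval, with complex exponent *)

Section CMellin.
Variable R : realType.
Implicit Types (a s t u : R) (z : R[i]).
Local Notation mu := (@lebesgue_measure R).
Local Notation normc := (@Normc.normc R).
Local Notation I01 := [set` `]0, 1[] (only parsing).

Lemma continuous_ReIm_cpow z u : 0 < u ->
  {for u, continuous (fun u => complex.Re (cpow u z))} /\
  {for u, continuous (fun u => complex.Im (cpow u z))}.
Proof.
move=> u0.
have clin (k : R) : {for u, continuous (fun u => k * ln u)}.
  by apply: cvgMr; exact: continuous_ln.
have cexpln : {for u, continuous (fun u => expR (complex.Re z * ln u))}.
  by apply: (@continuous_comp _ _ _ (fun u => _ * ln u) expR); [exact: clin|exact: continuous_expR].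
split.
- have -> : (fun u => complex.Re (cpow u z)) =
      (fun u => expR (complex.Re z * ln u) * cos (complex.Im z * ln u)).
    by apply/funext => v; rewrite /cpow /cexp Re_realM/= ReCM ImCM/= !mulr0 subr0 add0r.
  apply: cvgM; first exact: cexpln.
  by apply: (@continuous_comp _ _ _ (fun u => _ * ln u) (@cos R)); [exact: clin|exact: continuous_cos].
- have -> : (fun u => complex.Im (cpow u z)) =
      (fun u => expR (complex.Re z * ln u) * sin (complex.Im z * ln u)).
    by apply/funext => v; rewrite /cpow /cexp Im_realM/= ReCM ImCM/= !mulr0 subr0 add0r.
  apply: cvgM; first exact: cexpln.
  by apply: (@continuous_comp _ _ _ (fun u => _ * ln u) (@sin R)); [exact: clin|exact: continuous_sin].
Qed.

Definition cmellin z a t : R[i] := cpow (- ln t) (z - 1) * (t `^ (a - 1))%:C.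

Lemma I01P t : I01 t -> 0 < t /\ t < 1.
Proof. by rewrite /= in_itv/= => /andP. Qed.

Lemma lnN_gt0 t : 0 < t -> t < 1 -> 0 < - ln t.
Proof. by move=> t0 t1; rewrite oppr_gt0 ln_lt0// t0. Qed.

Lemma normc_cmellin z a t : 0 < t -> t < 1 ->
  normc (cmellin z a t) = mellin_kernel (complex.Re z) a t.
Proof.
move=> t0 t1; rewrite /cmellin Normc.normcM normc_cpow ?lnN_gt0//.
by rewrite normc_real ger0_norm ?powR_ge0// ReCD ReCN.
Qed.

Lemma cmeasurable_cmellin z a : cmeasurable I01 (cmellin z a).
Proof.
have ct (f : R -> R) : (forall u, 0 < u -> {for u, continuous f}) ->
    {in I01, continuous (fun t => f (- ln t) * t `^ (a - 1))}.
  move=> cf t /[!inE]/= /[!in_itv]/= /andP[t0 t1].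
  apply: cvgM; last exact: continuous_powR_pos.
  apply: (@continuous_comp _ _ _ (fun t => - ln t) f).
    by apply: cvgN; exact: continuous_ln.
  exact/cf/lnN_gt0.
split.
- have -> : (fun t => complex.Re (cmellin z a t)) =
      (fun t => complex.Re (cpow (- ln t) (z - 1)) * t `^ (a - 1)).
    by apply/funext => t; rewrite /cmellin mulrC Re_realM mulrC.
  apply: (@open_continuous_measurable_funS _ I01) => //.
  by apply: (ct (fun u => complex.Re (cpow u (z - 1)))) => u u0; have [] := continuous_ReIm_cpow (z - 1) u0.
- have -> : (fun t => complex.Im (cmellin z a t)) =
      (fun t => complex.Im (cpow (- ln t) (z - 1)) * t `^ (a - 1)).
    by apply/funext => t; rewrite /cmellin mulrC Im_realM mulrC.
  apply: (@open_continuous_measurable_funS _ I01) => //.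
  by apply: (ct (fun u => complex.Im (cpow u (z - 1)))) => u u0; have [] := continuous_ReIm_cpow (z - 1) u0.
Qed.

Lemma cintegrable_cmellin z a : 0 < complex.Re z -> 0 < a ->
  cintegrable I01 (cmellin z a).
Proof.
move=> z0 a0; apply: (cintegrable_le _ _ (integrable_mellin_kernel z0 a0)) => //.
  exact: cmeasurable_cmellin.
by move=> t /I01P[t0 t1]; rewrite normc_cmellin.
Qed.

(** Substitution [u = - a ln t] in Euler's integral. Of the factor [a^z], the part [a^(z-1)] enters
    the power of [u] and the remaining [a] is in the Jacobian [a / t]. *)
Lemma cintegral_cmellin z a : 0 < complex.Re z -> 0 < a ->
  cGamma z = cpow a z * cintegral I01 (cmellin z a).
Proof.
move=> z0 a0; rewrite -cintegralZ//; last exact: cintegrable_cmellin.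
have subst t : I01 t ->
    cpow a z * cmellin z a t =
    (a / t)%:C * (cpow (- (a * ln t)) (z - 1) * (expR (- - (a * ln t)))%:C).
  rewrite /= in_itv/= => /andP[t0 t1].
  rewrite /cmellin -[- (a * ln t)]mulrN cpowM ?lnN_gt0//.
  have -> : expR (- (a * - ln t)) = t `^ a by rewrite mulrN opprK /powR gt_eqF.
  rewrite powRB ?(gt_eqF t0) ?implybT// powRr1 ?ltW//.
  have -> : cpow a z = cpow a (z - 1) * a%:C.
    by rewrite -(cpow1 a0) -cpowD subrK.
  by rewrite !rmorphM/=; ring.
rewrite (eq_cintegral subst) /cGamma /cintegral; congr Complex.
- rewrite /Rintegral (integral_Mln a0).
    by congr fine; apply: eq_integral => t _; rewrite Re_realM mulrC.
  move=> u u0.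
  have -> : (fun u0 => complex.Re (cpow u0 (z - 1) * (expR (- u0))%:C)) =
    (fun u0 => complex.Re (cpow u0 (z - 1)) * expR (- 1 * u0)).
    by apply/funext => v; rewrite mulrC Re_realM mulrC mulN1r.
  apply: cvgM; last exact: continuous_expRMl.
  by have [] := continuous_ReIm_cpow (z - 1) u0.
- rewrite /Rintegral (integral_Mln a0).
    by congr fine; apply: eq_integral => t _; rewrite Im_realM mulrC.
  move=> u u0.
  have -> : (fun u0 => complex.Im (cpow u0 (z - 1) * (expR (- u0))%:C)) =
    (fun u0 => complex.Im (cpow u0 (z - 1)) * expR (- 1 * u0)).
    by apply/funext => v; rewrite mulrC Im_realM mulrC mulN1r.
  apply: cvgM; last exact: continuous_expRMl.
  by have [] := continuous_ReIm_cpow (z - 1) u0.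
Qed.

End CMellin.

(** * Gamma does not vanish *)

Section GammaNeq0.
Variable R : realType.
Implicit Types (a s t u x y : R) (z : R[i]).
Local Notation mu := (@lebesgue_measure R).
Local Notation normc := (@Normc.normc R).
Local Notation I01 := [set` `]0, 1[] (only parsing).

(** Restricting the increments to [1 / (n + 1)] makes the difference quotients a sequence, as
    dominated convergence requires. *)
Lemma is_derive_harmonic (f : R -> R) x d : is_derive x 1 f d ->
  n.+1%:R * (f (n.+1%:R^-1 + x) - f x) @[n --> \oo] --> d.
Proof.
move=> [df dfd]; have h0 : n.+1%:R^-1 @[n --> \oo] --> (0 : R)^'.
  move=> A hA; have h : \forall n \near \oo, n.+1%:R^-1 != 0 :> R -> A n.+1%:R^-1.
    exact: (@cvg_harmonic R _ hA).
  have : \forall n \near \oo, A n.+1%:R^-1.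
    by apply: filterS h => n; apply; rewrite invr_eq0 pnatr_eq0.
  exact.
move: df; rewrite /derivable => /cvgP/=; rewrite -/(derive f x 1) dfd => df.
have := cvg_comp _ _ h0 df; apply: cvg_trans; apply: near_eq_cvg.
by apply: nearW => n; rewrite /= invrK /GRing.scale/= mulr1.
Qed.

Lemma is_derive_expRMr (k : R) : is_derive (0 : R) 1 (fun x => expR (x * k)) k.
Proof.
have -> : (fun x => expR (x * k)) = expR \o (k *: @id R).
  by apply/funext => x /=; rewrite mulrC.
apply: is_derive_eq; rewrite [X in expR X](_ : _ = 0); last exact: mulr0.
by rewrite expR0 mul1r; exact: mulr1.
Qed.

Lemma cintegral_cmellinE z a : 0 < complex.Re z -> 0 < a ->
  cintegral I01 (cmellin z a) = cGamma z * cpow a (- z).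
Proof.
by move=> z0 a0; rewrite (cintegral_cmellin z0 a0) cpowN mulrAC divff ?mul1r ?cpow_neq0.
Qed.

Lemma cpow1s z : cpow 1 z = 1 :> R[i].
Proof. by rewrite /cpow ln1 mulr0 cexp0. Qed.

(* Derivative of [Gamma(z) a^(-z)] at [a = 1], taken under the integral sign
   along [a = 1 + 1 / (n + 1)]; it stands in for an integration by parts. *)
Lemma cGamma_step z : 0 < complex.Re z ->
  cvgc (fun n => n.+1%:R * (cGamma z * (1 - cpow (n.+1%:R^-1 + 1) (- z))))
    (cGamma (z + 1)).
Proof.
move=> z0; pose h (n : nat) : R := n.+1%:R^-1.
have h0 n : 0 < h n by rewrite invr_gt0.
have h10 n : 0 < h n + 1 by rewrite ltr_wpDr.
have z10 : 0 < complex.Re (z + 1) by rewrite ReCD/= ltr_wpDr.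
(* Difference quotient of [a -> - t^(a-1)] at [a = 1], against [(- ln t)^(z-1)]; in the limit it
   supplies one more factor [- ln t], which shifts [z] to [z + 1]. *)
pose f (n : nat) t : R[i] := n.+1%:R * (cmellin z 1 t + (-1) * cmellin z (h n + 1) t).
have i1 n := cintegrable_cmellin z0 (h10 n).
have i2 := cintegrable_cmellin z0 (@ltr01 R).
have i3 n := cintegrableZ (-1) (measurable_itv _) (i1 n).
have i4 n := cintegrableD (measurable_itv _) i2 (i3 n).
have -> : (fun n => n.+1%:R * (cGamma z * (1 - cpow (n.+1%:R^-1 + 1) (- z)))) =
    (fun n => cintegral I01 (f n)).
  apply/funext => n; rewrite (cintegralZ _ (measurable_itv _) (i4 n)).
  rewrite (cintegralD (measurable_itv _) i2 (i3 n)).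
  rewrite (cintegralZ _ (measurable_itv _) (i1 n)).
  by rewrite !cintegral_cmellinE// cpow1s mulr1 mulrBr mulr1 mulN1r.
have -> : cGamma (z + 1) = cintegral I01 (cmellin (z + 1) 1).
  by rewrite cintegral_cmellinE// cpow1s mulr1.
have fE n t : f n t = cpow (- ln t) (z - 1) * (n.+1%:R * (1 - t `^ h n))%:C.
  rewrite /f /cmellin subrr powRr0 addrK rmorphM rmorphB/= rmorph1 rmorph_nat.
  by ring.
have tE t n : 0 < t -> t `^ h n = expR (h n * ln t).
  by move=> t0; rewrite /powR gt_eqF.
apply: (cintegral_dominated (g := mellin_kernel (complex.Re z + 1) 1)) => //.
- by move=> n; apply: cintegrable_measurable; apply: cintegrableZ => //; exact: i4.
- move=> t /I01P[t0 t1].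
  have L0 := lnN_gt0 t0 t1.
  rewrite /cmellin subrr powRr0 mulr1 addrK.
  have -> : cpow (- ln t) z = cpow (- ln t) (z - 1) * (- ln t)%:C.
    by rewrite -(cpow1 L0) -cpowD subrK.
  under eq_fun do rewrite fE.
  apply: cvgcMl; apply: cvgc_ReIm => /=; last exact: cvg_cst.
  have d0 := is_derive_expRMr (ln t).
  have -> : (fun n => n.+1%:R * (1 - t `^ h n)) =
      (fun n => - (n.+1%:R * (expR ((n.+1%:R^-1 + 0) * ln t) - expR (0 * ln t)))).
    by apply/funext => n; rewrite tE// addr0 mul0r expR0 -mulrN opprB.
  by apply: cvgN; exact: is_derive_harmonic d0.
- by apply: integrable_mellin_kernel => //; rewrite ltr_wpDr// ltW.
- move=> n t /I01P[t0 t1].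
  have L0 := lnN_gt0 t0 t1.
  rewrite fE Normc.normcM normc_cpow// normc_real ReCD ReCN /=.
  rewrite /mellin_kernel subrr powRr0 mulr1 addrK.
  rewrite -[in X in _ <= _ `^ X](subrK 1 (complex.Re z)) [leRHS]powRD; last first.
    by rewrite (gt_eqF L0) implybT.
  rewrite powRr1 ?(ltW L0)// ler_wpM2l ?powR_ge0// tE//.
  have hl : 0 < h n * - ln t by rewrite mulr_gt0.
  have e1 : expR (h n * ln t) <= 1 by rewrite expR_le1 -oppr_ge0 -mulrN ltW.
  rewrite ger0_norm ?mulr_ge0 ?subr_ge0//.
  (* [1 - e^(-v) <= v] at [v = h n * - ln t] bounds the difference quotient by [- ln t], uniformly
     in [n]. *)
  have -> : - ln t = n.+1%:R * (h n * - ln t) by rewrite /h mulVKf ?pnatr_eq0.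
  rewrite ler_pM2l// lerBlDl -lerBlDr.
  by have := expR_ge1Dx (h n * ln t); rewrite mulrN opprK.
Qed.

(** Every difference quotient in [cGamma_step] carries the factor [cGamma z]. *)
Lemma cGamma_eq0S z : 0 < complex.Re z -> cGamma z = 0 -> cGamma (z + 1) = 0.
Proof.
move=> z0 g0; have := cGamma_step z0; rewrite g0.
under eq_fun do rewrite mul0r mulr0.
by move=> h; apply: (cvgc_unique h); exact: cvgc_cst.
Qed.

Lemma cGamma_eq0D z n : 0 < complex.Re z -> cGamma z = 0 -> cGamma (z + n%:R) = 0.
Proof.
move=> z0 g0; elim: n => [|n ih]; first by rewrite addr0.
rewrite -natr1 addrA cGamma_eq0S// ReCD natrC/=.
by rewrite ltr_wpDr.
Qed.

Definition rGamma s : R := \int[mu]_(t in I01) mellin_kernel s 1 t.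

Lemma cGamma_real s : 0 < s -> cGamma s%:C = (rGamma s)%:C.
Proof.
move=> s0; have := @cintegral_cmellinE s%:C 1 s0 ltr01.
rewrite cpow1s mulr1 => <-.
have E t : I01 t -> cmellin s%:C 1 t = (mellin_kernel s 1 t)%:C.
  move=> /I01P[t0 t1]; rewrite /cmellin /mellin_kernel rmorphM/=.
  by rewrite -(rmorph1 (real_complex R)) -rmorphB/= cpow_real// lnN_gt0.
rewrite (eq_cintegral E) /cintegral /=; congr Complex.
by rewrite /Rintegral integral0.
Qed.

(** [cGamma_step] at a real argument: the quotients tend to [- rGamma s] times the derivative of
    [a^(-s)] at [a = 1], which is [- s]. *)
Lemma rGammaS s : 0 < s -> rGamma (s + 1) = s * rGamma s.
Proof.
move=> s0; have := @cGamma_step s%:C s0.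
have -> : s%:C + 1 = (s + 1)%:C by rewrite rmorphD rmorph1.
rewrite !cGamma_real ?ltr_wpDr ?(ltW s0)//.
move=> /cvgc_Re h1.
have d1 := is_derive1_powR (- s) (@ltr01 R).
have {d1}h2 := is_derive_harmonic d1; move: h2; rewrite powR1 mulr1 => h2.
apply: (cvg_unique (@Rhausdorff R) h1).
have -> : (fun n => complex.Re (n.+1%:R * ((rGamma s)%:C *
      (1 - cpow (n.+1%:R^-1 + 1) (- s%:C))))) =
    (fun n => - rGamma s * (n.+1%:R * ((n.+1%:R^-1 + 1) `^ (- s) - 1))).
  apply/funext => n.
  have -> : - s%:C = (- s)%:C by rewrite rmorphN.
  rewrite natrC Re_realM Re_realM cpow_real ?ltr_wpDr//.
  by rewrite ReCD ReCN/=; ring.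
by rewrite -[s * _]mulrNN mulrC; exact: cvgMr.
Qed.

Lemma rGamma_gt0 s : 1 <= s -> 0 < rGamma s.
Proof.
move=> s1; have s0 : 0 < s by rewrite (lt_le_trans ltr01).
have hi := integrable_mellin_kernel s0 (@ltr01 R).
rewrite -lte_fin /rGamma /Rintegral fineK; last exact: integrable_fin_num.
have e1 : expR (-1) < 1 :> R by rewrite expR_lt1 ltrN10.
have mk : measurable_fun (`]0, 1[%classic : set (measurableTypeR R)) (fun t => (mellin_kernel s 1 t)%:E).
  by case/integrableP : hi.
(* On []0, e^(-1)[] one has [- ln t >= 1], so the kernel is at least 1 there. *)
apply: (@lt_le_trans _ _ (\int[mu]_(t in `]0%R, (expR (-1))[) (mellin_kernel s 1 t)%:E)%E); last first.
  apply: ge0_subset_integral => //.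
    by move=> t _; rewrite lee_fin mellin_kernel_ge0.
  by move=> t /=; rewrite !in_itv/= => /andP[-> /lt_trans]; apply.
apply: (@lt_le_trans _ _ (\int[mu]_(t in `]0%R, (expR (-1))[) 1)%E).
  by rewrite integral_cst//= lebesgue_measure_itv/= lte_fin expR_gt0 -EFinB subr0 mul1e lte_fin expR_gt0.
apply: ge0_le_integral => //.
  apply: measurable_funS mk => //.
  by move=> t /=; rewrite !in_itv/= => /andP[-> /lt_trans]; apply.
move=> t /=; rewrite in_itv/= => /andP[t0 te]; rewrite lee_fin.
rewrite /mellin_kernel subrr powRr0 mulr1 -[leLHS](powRr0 (- ln t)) ler_powR ?subr_ge0//.
by rewrite lerNr -[leRHS]expRK ler_ln ?posrE ?expR_gt0 ?ltW.
Qed.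

Lemma sin_le x : `|sin x| <= `|x|.
Proof.
wlog x0 : x / 0 <= x.
  move=> H; have [/H//|x0] := leP 0 x.
  by rewrite -(normrN x) -(normrN (sin x)) -sinN H// oppr_ge0 ltW.
have [|c _] := @MVT_segment R sin cos 0 x x0 (fun c _ => is_derive_sin c).
  by apply: continuous_subspaceT; exact: continuous_sin.
rewrite sin0 !subr0 => ->; rewrite normrM ler_piMl//.
by rewrite ler_norml cos_geN1 cos_le1.
Qed.

Lemma cos_ge x : 1 - x ^+ 2 / 2 <= cos x.
Proof.
have -> : cos x = 1 - 2 * sin (x / 2) ^+ 2.
  have {1}-> : x = x / 2 *+ 2 by rewrite -mulr_natr; field.
  rewrite cos_mulr2n cos2sin2 -mulr_natl; ring.
have := sin_le (x / 2); rewrite -(ler_pXn2r (n := 2)) ?nnegrE// !real_normK ?num_real//.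
by rewrite expr_div_n => h; lra.
Qed.

(** For [u = e^(2x)] the right side is [4 (e^x - e^(-x))^2], and [|x| <= |e^x - e^(-x)|]. A bound by
    powers of [u] is wanted because these integrate against the Gamma density to [Gamma(s + 1)] and
    [Gamma(s - 1)]. *)
Lemma ln_sqr_le u : 0 < u -> ln u ^+ 2 <= 4 * (u - 2 + u^-1).
Proof.
move=> u0; pose x := ln u / 2.
have -> : ln u = 2 * x by rewrite /x; field.
have uE : u = expR x ^+ 2.
  by rewrite -expRM_natl -(lnK u0); congr expR; rewrite /x; field.
have h : `|x| <= `|expR x - (expR x)^-1|.
  have e1 := expR_ge1Dx x; have e2 := expR_ge1Dx (- x).
  have [x0|x0] := leP 0 x.
    have e3 : expR (- x) <= 1 by rewrite expR_le1 oppr_le0.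
    rewrite -expRN ger0_norm// (le_trans _ (ler_norm _))//; lra.
  have e3 : expR x <= 1 by rewrite expR_le1 ltW.
  rewrite -expRN ltr0_norm// -normrN (le_trans _ (ler_norm _))//; lra.
move: h; rewrite -(ler_pXn2r (n := 2)) ?nnegrE// !real_normK ?num_real// => h.
have -> : u - 2 + u^-1 = (expR x - (expR x)^-1) ^+ 2.
  by rewrite uE; field; rewrite gt_eqF ?expR_gt0.
by rewrite exprMn; lra.
Qed.

Lemma mellin_kernelD s d t : 0 < t -> t < 1 ->
  mellin_kernel (s + d) 1 t = (- ln t) `^ d * mellin_kernel s 1 t.
Proof.
move=> t0 t1; rewrite /mellin_kernel addrAC [X in X * _]powRD.
  by rewrite mulrAC mulrC.
by rewrite (gt_eqF (lnN_gt0 t0 t1)) implybT.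
Qed.

(* [cos v >= 1 - v^2 / 2] and [(ln u)^2 <= 4 (u - 2 + 1 / u)] bound the real part
   of [s^(-iy) Gamma(s + iy)] below by [Gamma(s) (1 - 2 y^2 / (s - 1))]. *)
Lemma cGamma_neq0_large s y : 1 < s -> 2 * y ^+ 2 < s - 1 -> cGamma (s +i* y) != 0.
Proof.
move=> s1 hy; have s0 : 0 < s by lra.
have s1' := ltW s1.
apply/eqP => G0.
have z0 : 0 < complex.Re (s +i* y) by [].
have i1 := cintegrable_cmellin z0 (@ltr01 R).
(* The factor [s^(-iy)] turns [u^(iy)] into [(u / s)^(iy)], whose phase is zero at [u = s]. *)
have : cpow s (0 -i* y) * cintegral I01 (cmellin (s +i* y) 1) = 0.
  by rewrite cintegral_cmellinE// G0 mul0r mulr0.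
rewrite -cintegralZ//.
have E t : I01 t -> cpow s (0 -i* y) * cmellin (s +i* y) 1 t =
    (mellin_kernel s 1 t)%:C * cpow (- ln t / s) (0 +i* y).
  move=> /I01P[t0 t1]; have L0 := lnN_gt0 t0 t1.
  rewrite /cmellin /mellin_kernel subrr powRr0 !mulr1.
  have -> : s +i* y - 1 = (s - 1)%:C + (0 +i* y).
    by apply/eqP; rewrite eq_complex !ReCD !ImCD ReCN ImCN /= addr0 oppr0 addr0 add0r !eqxx.
  rewrite cpowD cpow_real// cpowM// ?invr_gt0//.
  have -> : cpow s^-1 (0 +i* y) = cpow s (0 -i* y).
    have -> : (0 -i* y) = - (0 +i* y) by apply/eqP; rewrite eq_complex /= oppr0 !eqxx.
    by rewrite /cpow lnV// rmorphN/= mulrN mulNr.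
  by ring.
rewrite (eq_cintegral E) => /(congr1 (@complex.Re R)) /=.
move=> I0.
have {E}i1 := eq_cintegrable (measurable_itv _) E (cintegrableZ (cpow s (0 -i* y)) (measurable_itv _) i1).
have [i2 _] := i1.
(* The kernel times [1 - 2 y^2 (v - 2 + 1 / v)] at [v = - ln t / s]; the powers [v] and [1 / v]
   shift the exponent by one up and down. By the recursion for [rGamma] its integral is
   [(s - 1 - 2 y^2) * rGamma (s - 1)]. *)
pose g t := (1 + 4 * y ^+ 2) * mellin_kernel s 1 t +
  (- (2 * y ^+ 2)) * (s^-1 * mellin_kernel (s + 1) 1 t + s * mellin_kernel (s - 1) 1 t).
have k1 := integrable_mellin_kernel s0 (@ltr01 R).
have k2 : mu.-integrable I01 (EFin \o mellin_kernel (s + 1) 1) by apply: integrable_mellin_kernel => //; lra.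
have k3 : mu.-integrable I01 (EFin \o mellin_kernel (s - 1) 1) by apply: integrable_mellin_kernel => //; lra.
have k4 := integrable_lincomb s^-1 s (measurable_itv _) k2 k3.
have k5 := integrable_lincomb (1 + 4 * y ^+ 2) (- (2 * y ^+ 2)) (measurable_itv _) k1 k4.
have := @le_Rintegral _ _ _ mu I01 g _ (measurable_itv _) k5 i2.
rewrite I0 /g Rintegral_lincomb// Rintegral_lincomb// -!/(rGamma _).
have gm : rGamma s = (s - 1) * rGamma (s - 1).
  by rewrite -rGammaS ?subrK//; lra.
have gs := rGamma_gt0 s1'; rewrite rGammaS// mulKf ?gt_eqF// gm.
have g1 : 0 < rGamma (s - 1).
  by move: gs; rewrite gm pmulr_rgt0//; lra.
move=> h.
have : 0 < (s - 1 - 2 * y ^+ 2) * rGamma (s - 1) by rewrite mulr_gt0//; lra.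
rewrite [ltRHS](_ : _ = (1 + 4 * y ^+ 2) * ((s - 1) * rGamma (s - 1)) +
  - (2 * y ^+ 2) * ((s - 1) * rGamma (s - 1) + s * rGamma (s - 1))); last by ring.
rewrite ltNge => /negP; apply; apply: h => t /I01P[t0 t1]; have L0 := lnN_gt0 t0 t1.
have v0 : 0 < - ln t / s by rewrite divr_gt0.
rewrite Re_realM Re_cpow//= powRr0 mul1r !mellin_kernelD//.
rewrite powRr1 ?(ltW L0)// powR_inv1 ?(ltW L0)//.
have := ln_sqr_le v0; have := cos_ge (y * ln (- ln t / s)).
rewrite exprMn invf_div; set v := ln (- ln t / s); set m := mellin_kernel s 1 t.
set L := - ln t in L0 v0 *; move=> hc hv.
have m0 : 0 <= m by exact: mellin_kernel_ge0.
rewrite [leLHS](_ : _ = m * (1 - 2 * y ^+ 2 * (L / s - 2 + s / L))); last by ring.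
rewrite ler_wpM2l// (le_trans _ hc)// lerD2l lerN2.
have := ler_wpM2l (sqr_ge0 y) hv; lra.
Qed.

Lemma cGamma_neq0 z : 0 < complex.Re z -> cGamma z != 0.
Proof.
case: z => s y /= s0; apply/eqP => g0.
(* Chosen so that [s + n] exceeds [1 + 2 y^2], which gives both hypotheses of
   [cGamma_neq0_large]. *)
pose n := (Num.truncn (1 + 2 * y ^+ 2)).+1.
have hn : 1 + 2 * y ^+ 2 < n%:R by exact: Num.Theory.truncnS_gt.
have y0 := sqr_ge0 y.
have := @cGamma_eq0D (s +i* y) n s0 g0.
have -> : s +i* y + n%:R = (s + n%:R) +i* y.
  by apply/eqP; rewrite eq_complex natrC ReCD ImCD /= addr0 !eqxx.
by apply/eqP/cGamma_neq0_large; lra.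
Qed.

End GammaNeq0.

(** * Double series *)

Section DoubleSums.
Variable R : realType.
Implicit Types (p q : nat -> R) (c : nat -> R[i]).
Local Notation normc := (@Normc.normc R).

(** Telescoping: by the mean value theorem, [d (n+2)^(-1-d)] is at most the drop of [x^(-d)] from
    [n + 1] to [n + 2]. In the bound [ub], the summand [d] accounts for the first term. *)
Lemma cvg_series_powR (d : R) : 0 < d ->
  cvgn (series (fun n => n.+1%:R `^ (- (1 + d)))).
Proof.
move=> d0; pose q (n : nat) : R := n.+1%:R `^ (- (1 + d)).
have dec n : d * q n.+1 <= n.+1%:R `^ (- d) - n.+2%:R `^ (- d).
  have nn : n.+1%:R < n.+2%:R :> R by rewrite ltr_nat.
  have [||k /[!in_itv]/= /andP[k1 k2]] := @MVT R (fun x => x `^ (- d))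
      (fun x => - d * x `^ (- d - 1)) _ _ nn.
  - move=> x /[!in_itv]/= /andP[x1 _]; apply: is_derive1_powR.
    by rewrite (lt_trans _ x1).
  - apply: continuous_in_subspaceT => x /[!inE]/= /[!in_itv]/= /andP[x1 _].
    by apply: continuous_powR_pos; rewrite (lt_le_trans _ x1).
  have -> : n.+2%:R - n.+1%:R = 1 :> R by rewrite -[n.+2]addn1 natrD addrAC subrr add0r.
  rewrite mulr1 mulNr => /(canRL (subrK _)) ->.
  rewrite opprD opprK addrCA subrr addr0 ler_pM2l// /q opprD addrC.
  have k0 : 0 < k by rewrite (lt_trans _ k1).
  have -> : - d - 1 = - (d + 1) by rewrite opprD.
  rewrite !(powRN _ (d + 1)) lef_pV2 ?posrE ?powR_gt0//.
  by rewrite ge0_ler_powR ?nnegrE ?addr_ge0 ?(ltW d0) ?(ltW k0)// ltW.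
have q0 n : 0 <= q n by exact: powR_ge0.
have ub n : d * series q n.+1 <= d + 1 - n.+1%:R `^ (- d).
  elim: n => [|n ih].
    by rewrite seriesEord/= big_ord1 /q !powR1 mulr1 addrK.
  rewrite seriesEord/= big_ord_recr/= mulrDr.
  by move: ih; rewrite seriesEord/= => ih; have := dec n; lra.
apply: nondecreasing_is_cvgn.
  by apply/nondecreasing_seqP => n; rewrite !seriesEord/= big_ord_recr/= lerDl.
exists (d^-1 * (d + 1)) => _ [n _ <-]; rewrite ler_pdivlMl//.
rewrite (@le_trans _ _ (d * series q n.+1))//.
  by rewrite ler_pM2l// !seriesEord/= big_ord_recr/= lerDl.
by rewrite (le_trans (ub n))// gerBl powR_ge0.
Qed.

Lemma normc_le_limit (u : nat -> R[i]) z (b : R) (w : R[i]) N : cvgc u z ->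
  (forall n, (N <= n)%N -> normc (u n - w) <= b) -> normc (z - w) <= b.
Proof.
move=> uz ub.
have h : normc (u n - z) + b @[n --> \oo] --> 0 + b.
  by apply: cvgD; [exact: uz|exact: cvg_cst].
rewrite -(add0r b); apply: (cvgr_to_ge h); near=> n.
have Nn : (N <= n)%N by near: n; exact: nbhs_infty_ge.
have -> : z - w = - (u n - z) + (u n - w) by ring.
by rewrite (le_trans (complex.le_normcD _ _))// complex.normcN lerD2l ub.
Unshelve. all: by end_near. Qed.

Lemma sumr_nat_le p : (forall n, 0 <= p n) -> cvgn (series p) ->
  forall N, \sum_(n < N) p n <= limn (series p).
Proof.
move=> p0 cp N; have : series p N <= limn (series p).
  apply: nondecreasing_cvgn_le => //.
  by apply/nondecreasing_seqP => n; rewrite !seriesEord/= big_ord_recr/= lerDl.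
by rewrite seriesEord.
Qed.

(** Besides convergence, the explicit tail estimate is recorded: it controls all rows of a double
    series at once. *)
Lemma cvgc_series c p : (forall n, normc (c n) <= p n) -> cvgn (series p) ->
  exists2 L, cvgc (fun N => \sum_(n < N) c n) L &
    forall N, normc (L - \sum_(n < N) c n) <= limn (series p) - \sum_(n < N) p n.
Proof.
move=> cp ip; have p0 n : 0 <= p n := le_trans (normc_ge0 _) (cp n).
have part (f : nat -> R) : (forall n, `|f n| <= normc (c n)) ->
    exists l : R, \sum_(n < N) f n @[N --> \oo] --> l.
  move=> fc; have /normed_cvg/cvg_ex[l fl] : cvgn [normed series f].
    apply: (series_le_cvg _ p0 _ ip) => n; first exact: normr_ge0.
    by rewrite (le_trans (fc n)).
  by exists l; move: fl; rewrite seriesEord.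
have [a ra] := part _ (fun n => Re_le_normc (c n)).
have [b ib] := part _ (fun n => Im_le_normc (c n)).
have cL : cvgc (fun N => \sum_(n < N) c n) (a +i* b).
  apply: cvgc_ReIm => /=.
    by under eq_fun do rewrite Re_sum.
  by under eq_fun do rewrite Im_sum.
exists (a +i* b) => // N; apply: (normc_le_limit (N := N) cL) => M NM.
rewrite lerBrDr; apply: le_trans (sumr_nat_le p0 ip M).
rewrite -(subnKC NM) !big_split_ord /= addrAC subrr add0r [leRHS]addrC lerD2r.
by rewrite (le_trans (normc_sum _ _ _))// ler_sum.
Qed.

Lemma cvgc_eq (u v : nat -> R[i]) z : (forall n, u n = v n) -> cvgc u z -> cvgc v z.
Proof. by move=> uv; have -> : u = v by exact/funext. Qed.

Lemma cvgc_comp (u : nat -> R[i]) z (N : nat -> nat) : cvgc u z ->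
  (N n @[n --> \oo] --> \oo) -> cvgc (fun k => u (N k)) z.
Proof. by move=> uz hN; exact: (cvg_comp _ _ hN uz). Qed.

Lemma cvgc_limn c L : cvgc (fun N => \sum_(n < N) c n) L ->
  cvgn (series (c : nat -> (R[i] : numFieldType))) /\
  limn (series (c : nat -> (R[i] : numFieldType))) = L.
Proof.
move=> /cvgc_numField h.
have {}h : series (c : nat -> (R[i] : numFieldType)) @ \oo --> (L : (R[i] : numFieldType)).
  by rewrite seriesEord.
by split; [apply/cvg_ex; exists L|apply: cvg_lim => //; exact: norm_hausdorff].
Qed.

(** Cutting row [n] at [M] loses at most [|C| p n] times the tail of [p] after [M]. Summed over
    [n < M] this is at most [|C| B] times that tail, hence tends to 0, so square sums and sums of
    full rows have the same limit. [N] selects the sides of the squares. *)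
Lemma iterated_square (a : nat -> nat -> R[i]) p (C : R) (N : nat -> nat) :
  (forall n, 0 <= p n) -> cvgn (series p) ->
  (forall n m, normc (a n.+1 m.+1) <= C * (p n * p m)) ->
  (N k @[k --> \oo] --> \oo) ->
  iterated_cvg (a : nat -> nat -> (R[i] : numFieldType)) /\
  cvgc (fun k => \sum_(n < N k) \sum_(m < N k) a n.+1 m.+1)
    (iterated_sum (a : nat -> nat -> (R[i] : numFieldType))).
Proof.
move=> p0 ip hap hN; set B := limn (series p).
have B0 : 0 <= B by have := sumr_nat_le p0 ip 0; rewrite big_ord0.
have hap' n m : normc (a n.+1 m.+1) <= (`|C| * p n) * p m.
  rewrite (le_trans (hap n m))// mulrA ler_wpM2r// ler_wpM2r//.
  exact: ler_norm.
have scale k : cvgn (series (fun m => k * p m)) /\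
    limn (series (fun m => k * p m)) = k * B.
  have h : series (fun m => k * p m) @ \oo --> k * B.
    have -> : series (fun m => k * p m) = (fun n => k * series p n).
      by apply/funext => n; rewrite !seriesEnat/= mulr_sumr.
    exact: cvgMr.
  by split; [apply/cvg_ex; exists (k * B)|apply/cvg_lim].
have inner n : exists L, cvgc (fun M => \sum_(m < M) a n.+1 m.+1) L /\
    forall M, normc (L - \sum_(m < M) a n.+1 m.+1) <=
      `|C| * p n * (B - \sum_(m < M) p m).
  have [cv lv] := scale (`|C| * p n).
  have [L hL hb] := cvgc_series (hap' n) cv.
  by exists L; split => // M; rewrite (le_trans (hb M))// lv mulrBr mulr_sumr.
have /boolp.choice[A hA] := inner.
have limA n : limn (series (fun m => (a n.+1 m.+1 : (R[i] : numFieldType)))) = A n.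
  by have [hL _] := hA n; have [] := @cvgc_limn (fun m => a n.+1 m.+1) _ hL.
have boundA n : normc (A n) <= (`|C| * B) * p n.
  have [_ /(_ 0%N)] := hA n; rewrite !big_ord0 !subr0 => h.
  by rewrite (le_trans h)// mulrAC.
have [cv _] := scale (`|C| * B).
have [S hS _] := cvgc_series boundA cv.
have [cS lS] := cvgc_limn hS.
have eA : (fun n => limn (series (fun m => (a n.+1 m.+1 : (R[i] : numFieldType))))) = A.
  by apply/funext => n; exact: limA.
have itS : iterated_sum (a : nat -> nat -> (R[i] : numFieldType)) = S.
  by rewrite /iterated_sum eA.
split.
  split; last by rewrite eA.
  by move=> n; have [hL _] := hA n; have [] := @cvgc_limn (fun m => a n.+1 m.+1) _ hL.
rewrite itS.
have err M : normc (\sum_(n < M) \sum_(m < M) a n.+1 m.+1 - \sum_(n < M) A n) <=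
    `|C| * B * (B - \sum_(m < M) p m).
  have tl : 0 <= B - \sum_(m < M) p m by rewrite subr_ge0 sumr_nat_le.
  rewrite -sumrB (le_trans (normc_sum _ _ _))//.
  apply: (@le_trans _ _ (\sum_(n < M) `|C| * p n * (B - \sum_(m < M) p m))).
    by apply: ler_sum => n _; rewrite normc_subC; have [_] := hA n; apply.
  rewrite -mulr_suml ler_wpM2r// -mulr_sumr ler_wpM2l//.
  exact: sumr_nat_le.
have e0 : `|C| * B * (B - \sum_(m < M) p m) @[M --> \oo] --> 0.
  have z : `|C| * B * (B - B) = 0 by rewrite subrr mulr0.
  rewrite -[X in _ --> X]z; apply: cvgMr; apply: cvgB; first exact: cvg_cst.
  by move: (ip : series p @ \oo --> B); rewrite {1}seriesEord.
have hd : cvgc (fun M => \sum_(n < M) \sum_(m < M) a n.+1 m.+1 - \sum_(n < M) A n) 0.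
  by apply: cvgc_le e0 => M; rewrite subr0.
have := cvgcD hd hS; rewrite add0r => h.
apply: (cvgc_comp (u := fun M => \sum_(n < M) \sum_(m < M) a n.+1 m.+1)) hN.
by apply: cvgc_eq h => M; exact: subrK.
Qed.

End DoubleSums.

(** * Gauss sums *)

Section PeriodicSums.
Variable K : nzRingType.
Variables (r : nat) (f : int -> K).
Hypothesis fper : forall n, f (n + r%:Z) = f n.

Lemma periodic_dvdz a b : (r%:Z %| a - b)%Z -> f a = f b.
Proof.
have pos (n : nat) c : f (c + n%:Z * r%:Z) = f c.
  elim: n => [|n ih]; first by rewrite mul0r addr0.
  by rewrite intS mulrDl mul1r [X in c + X]addrC addrA fper ih.
move=> /dvdzP[q /(canRL (subrK _)) ->]; rewrite addrC.
by case: (intP q) => [|n|n]; rewrite ?mul0r ?addr0 ?pos// -{2}[b](subrK (n.+1%:Z * r%:Z)) pos mulNr.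
Qed.

Lemma big_periodic_ord : \sum_(1 <= j < r.+1) f j%:Z = \sum_(j < r) f j%:Z.
Proof.
case: r fper => [|r'] fp; first by rewrite big_geq// big_ord0.
rewrite big_nat_recr//= -[in f r'.+1%:Z](add0r r'.+1%:Z) fp.
rewrite -(big_mkord xpredT (fun j => f j%:Z)) [RHS]big_ltn// addrC.
by rewrite big_add1.
Qed.

End PeriodicSums.

(** Multiplication by a unit permutes the residues modulo [r]; the permutation lives on ['I_r], so
    the range is first shifted to start at 0. *)
Lemma big_periodic_mul (K : nzRingType) (r : nat) (f : int -> K) a :
  (forall n, f (n + r%:Z) = f n) -> (0 < r)%N -> coprimez a r%:Z ->
  \sum_(1 <= j < r.+1) f (j%:Z * a) = \sum_(1 <= j < r.+1) f j%:Z.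
Proof.
move=> fper r0 ar; rewrite [RHS]big_periodic_ord//.
rewrite (@big_periodic_ord _ r (fun j => f (j * a))); last first.
  move=> n; apply: (periodic_dvdz fper).
  by rewrite mulrDl addrAC subrr add0r dvdz_mulr.
case: r r0 fper ar => // r _ fper ar.
have rn0 : r.+1%:Z != 0 by [].
have hlt (j : int) : (`|(j * a %% r.+1%:Z)%Z| < r.+1)%N.
  by rewrite -ltz_nat gez0_abs ?modz_ge0// ltz_mod.
pose h (j : 'I_r.+1) := Ordinal (hlt j%:Z).
have hE j : (h j)%:Z = ((j%:Z * a) %% r.+1%:Z)%Z by rewrite /= gez0_abs// modz_ge0.
have hinj : injective h.
  move=> i j /(congr1 (fun k : 'I_r.+1 => (k : nat)%:Z)).
  rewrite !hE => /eqP; rewrite eqz_mod_dvd -mulrBl Gauss_dvdzl; last by rewrite coprimez_sym.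
  rewrite -eqz_mod_dvd !modz_small ?ltz_nat ?ltn_ord// => /eqP[] ij.
  exact: val_inj.
rewrite [RHS](reindex_inj hinj); apply: eq_bigr => j _.
apply: (periodic_dvdz fper); rewrite -eqz_mod_dvd hE modz_mod//.
Qed.

(** * Roots of unity, Dirichlet characters and conductors *)

Section Characters.
Variable R : realType.
Implicit Types (r : nat) (chi : int -> R[i]).
Local Notation normc := (@Normc.normc R).

Lemma zetaD r k l : zeta R r (k + l) = zeta R r k * zeta R r l.
Proof.
rewrite /zeta -cexpD; congr cexp; apply/eqP; rewrite eq_complex ReCD ImCD /= addr0 eqxx.
by rewrite rmorphD/= mulrDr mulrDl.
Qed.

Lemma zeta0 r : zeta R r 0 = 1.
Proof. by rewrite /zeta mulr0 mul0r cexp0. Qed.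

Lemma normc_zeta r k : normc (zeta R r k) = 1.
Proof. by rewrite /zeta normc_cexp/= expR0. Qed.

Lemma zeta_period r k : (0 < r)%N -> zeta R r (k + r%:Z) = zeta R r k.
Proof.
move=> r0; rewrite zetaD; have -> : zeta R r r%:Z = 1; last by rewrite mulr1.
rewrite /zeta /cexp /= mulfK ?pnatr_eq0 -?lt0n// mulr_natl.
by rewrite expR0 cos2pi sin2pi mul1r.
Qed.

Lemma zetaMn r k n : zeta R r (k * n%:Z) = zeta R r k ^+ n.
Proof.
elim: n => [|n ih]; first by rewrite mulr0 zeta0 expr0.
by rewrite intS mulrDr mulr1 zetaD ih exprS.
Qed.

Section Dirichlet.
Variables (r : nat) (chi : int -> R[i]).
Hypothesis r0 : (0 < r)%N.
Hypothesis dchi : dirichlet_character r chi.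

Let chi1 : chi 1 = 1. Proof. by case: dchi. Qed.
Let chiM m n : chi (m * n) = chi m * chi n. Proof. by case: dchi. Qed.
Let chi_per n : chi (n + r%:Z) = chi n. Proof. by case: dchi. Qed.
Let chi_neq0 n : (chi n != 0) = coprimez n r%:Z. Proof. by case: dchi. Qed.

Lemma gauss_sum_period l : gauss_sum r (l + r%:Z) chi = gauss_sum r l chi.
Proof.
rewrite /gauss_sum; apply: eq_bigr => j _; congr (_ * _).
apply: (@periodic_dvdz _ r (zeta R r)); first by move=> n; exact: zeta_period.
by rewrite mulrDr addrAC subrr add0r dvdz_mull.
Qed.

Lemma normc_gauss_sum l :
  normc (gauss_sum r l chi) <= \sum_(1 <= j < r.+1) normc (chi j%:Z).
Proof.
rewrite (le_trans (normc_sum _ _ _))//; apply: ler_sum => j _.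
by rewrite Normc.normcM normc_zeta mulr1.
Qed.

(** Substitution [j -> a j] in the Gauss sum. *)
Lemma gauss_sumM a m : coprimez a r%:Z ->
  gauss_sum r m chi = chi a * gauss_sum r (a * m) chi.
Proof.
move=> ar; rewrite /gauss_sum.
rewrite -(@big_periodic_mul _ r (fun j => chi j * zeta R r (j * m)) a)//.
  by rewrite mulr_sumr; apply: eq_bigr => j _; rewrite chiM -(mulrA j%:Z a m); ring.
move=> n; rewrite chi_per; congr (_ * _).
apply: (@periodic_dvdz _ r (zeta R r)); first by move=> k; exact: zeta_period.
by rewrite mulrDl addrAC subrr add0r dvdz_mulr.
Qed.

(** By Euler's theorem [chi n] is a root of unity of order dividing [totient r]. That theorem
    concerns natural numbers, so [n] is first replaced by its remainder modulo [r]. *)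
Lemma normc_chi n : coprimez n r%:Z -> normc (chi n) = 1.
Proof.
move=> nr; have [e e0 he] : exists2 e, (0 < e)%N & chi n ^+ e = 1.
  exists (totient r); first by rewrite totient_gt0.
  have chiX k : chi n ^+ k = chi (n ^+ k).
    elim: k => [|k ih]; first by rewrite !expr0.
    by rewrite !exprS chiM ih.
  rewrite chiX -chi1.
  have [m mn] : exists m : nat, chi n = chi m%:Z /\ coprime m r.
    have h : (0 <= (n %% r%:Z)%Z) by rewrite modz_ge0// -lt0n.
    exists `|(n %% r%:Z)%Z|%N; split.
      apply: (periodic_dvdz chi_per).
      by rewrite -eqz_mod_dvd gez0_abs// modz_mod.
    have : coprimez (n %% r%:Z)%Z r%:Z by rewrite /coprimez gcdz_modl.
    by rewrite coprimezE.
  move: mn => [mn mr]; rewrite -chiX mn.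
  have -> : chi m%:Z ^+ totient r = chi (m ^ totient r)%N%:Z.
    by elim: (totient r) => [|k ih]; rewrite ?expr0 ?expn0// exprS expnS PoszM chiM ih.
  apply: (periodic_dvdz chi_per); rewrite -eqz_mod_dvd !modz_nat.
  by apply/eqP; congr Posz; exact: cyclic.Euler_exp_totient.
have := congr1 normc he; rewrite normcX Normc.normc1 => /eqP.
by rewrite pexpr_eq1 ?normc_ge0// => /eqP.
Qed.

Lemma conjc_chi n : coprimez n r%:Z -> (chi n)^* * chi n = 1.
Proof.
move=> nr; rewrite mulrC -sqr_normc normC_normc normc_chi//.
by rewrite expr1n.
Qed.

Lemma gauss_sum_coprime m : coprimez m r%:Z ->
  gauss_sum r m chi = (chi m)^* * gauss_sum r 1 chi.
Proof.
by move=> mr; rewrite (gauss_sumM 1 mr) mulr1 mulrA conjc_chi// mul1r.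
Qed.

Lemma normc_conj_chi_le1 n : normc (chi n)^* <= 1.
Proof.
have -> : normc (chi n)^* = normc (chi n).
  by case: (chi n) => a b /=; rewrite sqrrN.
have [nr|] := boolP (coprimez n r%:Z); first by rewrite normc_chi.
by rewrite -chi_neq0 negbK => /eqP->; rewrite Normc.normc0.
Qed.

Lemma coprimez_inv n : coprimez n r%:Z -> exists u, (r%:Z %| n * u - 1)%Z.
Proof.
move=> /coprimezP[[u v]/= huv]; exists u.
have -> : n * u - 1 = - v * r%:Z by rewrite -huv; ring.
by rewrite dvdz_mull.
Qed.

Lemma dvdn_prime_coprime (a b : nat) : (0 < b)%N ->
  (forall p, prime p -> (p %| b)%N -> ~~ (p %| a)%N) -> coprime a b.
Proof.
move=> b0 h; rewrite /coprime eqn_leq gcdn_gt0 b0 orbT andbT leqNgt.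
apply/negP => g1; have pp := pdiv_prime g1; have pg := pdiv_dvd (gcdn a b).
by have := h _ pp (dvdn_trans pg (dvdn_gcdr _ _)); rewrite (dvdn_trans pg (dvdn_gcdl _ _)).
Qed.

(* [n + d k] is prime to [r] when [k] is the product of the primes dividing
   [r] but not [n]. *)
Definition coprime_lift (d n : nat) : nat :=
  (n + d * \prod_(p <- primes r | ~~ (p %| n)) p)%N.

(** A prime of [r] that divides [n] divides neither [d] nor the product; a prime of [r] that does
    not divide [n] divides the product. In either case it divides exactly one of the two
    summands. *)
Lemma coprime_coprime_lift d n : coprime n d -> (d %| r)%N ->
  coprime (coprime_lift d n) r.
Proof.
move=> nd dr; apply: dvdn_prime_coprime => // p pp pr; rewrite /coprime_lift.
have pin : p \in primes r by rewrite mem_primes pp r0.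
have [pn|pn] := boolP (p %| n)%N.
  rewrite dvdn_addr// Euclid_dvdM//; apply/norP; split.
    apply/negP => pd; have : (p %| gcdn n d)%N by rewrite dvdn_gcd pn.
    by rewrite (eqP nd) dvdn1 => /eqP p1; rewrite p1 in pp.
  apply/negP; rewrite -big_filter Euclid_dvd_prod// big_has => /hasP[q].
  rewrite mem_filter mem_primes => /andP[qn /and3P[qp _ _]].
  by rewrite dvdn_prime2// => /eqP pq; rewrite -pq pn in qn.
rewrite dvdn_addl// dvdn_mull//.
by rewrite (big_rem p)//= pn dvdn_mulr.
Qed.

Section Conductor.
(* A character that is trivial on the units congruent to 1 modulo [d] is induced
   from modulus [d]. *)
Variable d : nat.
Hypotheses (d0 : (0 < d)%N) (dr : (d %| r)%N).
Hypothesis chi_triv : forall a, coprimez a r%:Z -> (d%:Z %| a - 1)%Z -> chi a = 1.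

(** If [u] inverts [b] modulo [r], then [a u] is a unit congruent to 1 modulo [d], so [chi a] and
    [chi b] have the same inverse [chi u]. *)
Lemma chi_congr a b : coprimez a r%:Z -> coprimez b r%:Z ->
  (d%:Z %| a - b)%Z -> chi a = chi b.
Proof.
move=> ar br dab; have [u hu] := coprimez_inv br.
have bu : chi b * chi u = 1.
  by rewrite -chiM -chi1; apply: (periodic_dvdz chi_per).
have ur : coprimez u r%:Z.
  by rewrite -chi_neq0; apply/eqP => u0; move: bu; rewrite u0 mulr0 => /esym/eqP; rewrite oner_eq0.
have au : chi a * chi u = 1.
  rewrite -chiM; apply: chi_triv; first by rewrite coprimezMl ar ur.
  have -> : a * u - 1 = (a - b) * u + (b * u - 1) by ring.
  rewrite rpredD//; first exact: dvdz_mulr.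
  by apply: dvdz_trans hu.
have un : chi u != 0 by rewrite chi_neq0.
by apply: (mulIf un); rewrite au bu.
Qed.

(** An integer prime to [d] need not be prime to [r], where [chi] would vanish; it is moved within
    its class modulo [d] to a unit modulo [r]. Starting from the remainder of [n] makes the result
    periodic modulo [d]. *)
Let lift (n : int) : int := (coprime_lift d `|(n %% d%:Z)%Z|%N)%:Z.
Let psi (n : int) : R[i] := if coprimez n d%:Z then chi (lift n) else 0.

Let dz : d%:Z != 0. Proof. by rewrite -lt0n. Qed.

Let lift_congr n : (d%:Z %| lift n - n)%Z.
Proof.
rewrite /lift /coprime_lift PoszD PoszM gez0_abs ?modz_ge0//.
rewrite addrAC rpredD ?dvdz_mulr// -eqz_mod_dvd modz_mod//.
Qed.

Let lift_coprime n : coprimez n d%:Z -> coprimez (lift n) r%:Z.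
Proof.
move=> nd; rewrite coprimezE; apply: coprime_coprime_lift => //.
have : coprimez (n %% d%:Z)%Z d%:Z by rewrite /coprimez gcdz_modl.
by rewrite coprimezE.
Qed.

Lemma induced_character : exists2 psi : int -> R[i], dirichlet_character d psi &
  forall n, coprimez n r%:Z -> chi n = psi n.
Proof.
have rd n : coprimez n r%:Z -> coprimez n d%:Z by move=> nr; exact: coprimez_dvdr nr.
have psiE n : coprimez n r%:Z -> chi n = psi n.
  move=> nr; rewrite /psi rd//; apply: chi_congr => //; first exact/lift_coprime/rd.
  by rewrite -opprB rpredN.
exists psi => //; split.
- by rewrite -psiE// coprimezE/= coprime1n.
- move=> m n; rewrite /psi coprimezMl.
  have [md|] := boolP (coprimez m d%:Z); last by rewrite mul0r.
  have [nd|] := boolP (coprimez n d%:Z); last by rewrite mulr0.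
  rewrite -chiM; apply: chi_congr.
  + by apply: lift_coprime; rewrite coprimezMl md.
  + by rewrite coprimezMl !lift_coprime.
  (* The lift is not multiplicative, but the lift of the product and the product of the lifts are
     units modulo [r] congruent modulo [d], which suffices for [chi_congr]. *)
  have -> : lift (m * n) - lift m * lift n = (lift (m * n) - m * n) -
    (lift m - m) * lift n - m * (lift n - n) by ring.
  by apply: rpredB; [apply: rpredB|]; [|apply: dvdz_mulr|apply: dvdz_mull];
    exact: lift_congr.
- move=> n; rewrite /psi /lift modzDr.
  by have -> : coprimez (n + d%:Z) d%:Z = coprimez n d%:Z by rewrite -!(coprimez_sym d%:Z) /coprimez gcdzDr.
- move=> n; rewrite /psi; case: ifPn => nd; last by rewrite eqxx.
  by rewrite chi_neq0 lift_coprime.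
Qed.

End Conductor.
End Dirichlet.

(** When [m] shares a factor with [r], the right side is 0. If [G(m)] were not, [chi] would be
    trivial on the units congruent to 1 modulo [d = r / gcd(m, r)], hence induced from the proper
    divisor [d]. *)
Lemma gauss_sum_primitive r chi m : (0 < r)%N -> primitive_character r chi ->
  gauss_sum r m chi = (chi m)^* * gauss_sum r 1 chi.
Proof.
move=> r0 [dchi prim]; have [mr|mr] := boolP (coprimez m r%:Z).
  exact: gauss_sum_coprime.
have chim : chi m = 0.
  by case: dchi => _ _ _ /(_ m); rewrite (negbTE mr) => /negbFE/eqP.
rewrite chim conjC0 mul0r; apply/eqP/negPn/negP => G0.
pose g := gcdn `|m| r; pose d := (r %/ g)%N.
have g0 : (0 < g)%N by rewrite gcdn_gt0 r0 orbT.
have gr : (g %| r)%N by exact: dvdn_gcdr.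
have rE : r = (d * g)%N by rewrite divnK.
have d0 : (0 < d)%N by rewrite divn_gt0// dvdn_leq.
have dr : (d %| r)%N by rewrite rE dvdn_mulr.
have g1 : (1 < g)%N.
  by move: mr; rewrite coprimezE /coprime -/g; case: (g) g0 => [|[]].
have dltr : (d < r)%N by rewrite rE ltn_Pmulr.
(* [j -> a j] fixes [G(m)] up to [chi a], and [a m = m] modulo [r]. *)
have triv a : coprimez a r%:Z -> (d%:Z %| a - 1)%Z -> chi a = 1.
  move=> ar da; have := gauss_sumM r0 dchi m ar.
  have -> : gauss_sum r (a * m) chi = gauss_sum r m chi.
    apply: (@periodic_dvdz _ r (fun l => gauss_sum r l chi)).
      by move=> n; exact: gauss_sum_period.
    have -> : a * m - m = (a - 1) * m by ring.
    have gm : (g%:Z %| m)%Z by rewrite dvdzE; exact: dvdn_gcdl.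
    by rewrite [X in (X%:Z %| _)%Z]rE PoszM dvdz_mul.
  by rewrite -[LHS]mul1r => /(mulIf G0).
have [psi dpsi hpsi] := induced_character r0 dchi d0 dr triv.
exact: prim dr dltr dpsi hpsi.
Qed.

End Characters.

(** * Expansion of J *)

Section GeneratingSeries.
Variable R : realType.
Implicit Types (u w : R[i]) (t x : R).
Local Notation normc := (@Normc.normc R).

Lemma cvg_muln (r : nat) : (0 < r)%N -> (r * k)%N @[k --> \oo] --> \oo.
Proof.
move=> r0 A [N _ hA]; exists N => // k Nk; apply: hA => /=.
by rewrite (leq_trans Nk)// leq_pmull.
Qed.

Lemma one_sub_neq0 u : normc u < 1 -> 1 - u != 0.
Proof.
move=> u1; apply/eqP => /eqP; rewrite subr_eq0 => /eqP h.
by move: u1; rewrite -h Normc.normc1 ltxx.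
Qed.

Lemma cvgc_expr u : normc u < 1 -> cvgc (fun n => u ^+ n) 0.
Proof.
move=> u1; apply: (@cvgc_le _ _ _ (fun n => normc u ^+ n)).
  by move=> n; rewrite subr0 normcX.
by apply: cvg_expr; rewrite ger0_norm ?normc_ge0.
Qed.

(** After [k] whole periods the partial sum is exactly [1 - u^(r k)] times the limit. *)
Lemma cvgc_periodic_series (r : nat) (c : nat -> R[i]) u : (0 < r)%N ->
  (forall n, c (n + r)%N = c n) -> normc u < 1 ->
  cvgc (fun k => \sum_(n < r * k) c n.+1 * u ^+ n.+1)
    ((\sum_(1 <= l < r.+1) c l * u ^+ l) / (1 - u ^+ r)).
Proof.
move=> r0 cr u1.
have ur1 : normc (u ^+ r) < 1 by rewrite normcX exprn_ilt1 ?normc_ge0// -lt0n.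
have nz := one_sub_neq0 ur1.
pose S := \sum_(1 <= l < r.+1) c l * u ^+ l.
have SE : S = \sum_(l < r) c l.+1 * u ^+ l.+1.
  by rewrite /S big_add1 big_mkord.
have ck k n : c (r * k + n)%N = c n.
  elim: k => [|k ih]; first by rewrite muln0.
  by rewrite mulnSr addnAC cr ih.
have part k : \sum_(n < r * k) c n.+1 * u ^+ n.+1 = (1 - (u ^+ r) ^+ k) * (S / (1 - u ^+ r)).
  elim: k => [|k ih]; first by rewrite muln0 big_ord0 expr0 subrr mul0r.
  rewrite mulnSr big_split_ord/= ih.
  under [X in _ + X]eq_bigr => l _.
    rewrite -addnS ck exprD mulrCA; over.
  by rewrite -mulr_sumr -SE exprM exprS; field.
rewrite -/S -[S / _]mul1r.
have := cvgcM (cvgcD (cvgc_cst 1) (cvgcN (cvgc_expr ur1))) (cvgc_cst (S / (1 - u ^+ r))).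
by rewrite oppr0 addr0; apply: cvgc_eq => k; rewrite part.
Qed.

Lemma cvgc_log_series (r : nat) (chi : int -> R[i]) x t : (0 < r)%N ->
  0 < x -> 0 < t -> t < 1 ->
  cvgc (fun k => \sum_(m < r * k)
      gauss_sum r m.+1%:Z chi / m.+1%:R * ((t `^ x) ^+ m.+1)%:C)
    (- \sum_(1 <= j < r.+1) chi j%:Z * clog (1 - zeta R r j%:Z * (t `^ x)%:C)).
Proof.
move=> r0 x0 t0 t1.
have tx0 : 0 <= t `^ x by exact: powR_ge0.
have tx1 : t `^ x < 1.
  rewrite /powR gt_eqF// -[ltRHS]expR0 ltr_expR pmulr_rlt0// ln_lt0// t0//.
have w1 j : normc (zeta R r j * (t `^ x)%:C) < 1.
  by rewrite Normc.normcM normc_zeta mul1r normc_real ger0_norm.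
rewrite -sumrN; apply: (cvgc_eq (u := fun k => \sum_(1 <= j < r.+1) chi j%:Z *
    (\sum_(m < r * k) (zeta R r j%:Z * (t `^ x)%:C) ^+ m.+1 / m.+1%:R))).
  move=> k; under eq_bigr do rewrite mulr_sumr.
  rewrite exchange_big; apply: eq_bigr => m _ /=.
  rewrite /gauss_sum mulr_suml mulr_suml; apply: eq_bigr => j _.
  by rewrite zetaMn exprMn rmorphXn/=; ring.
apply: cvgc_sum => j; rewrite -mulrN; apply: cvgcMl.
apply: (cvgc_comp (u := fun N => \sum_(m < N) (zeta R r j%:Z * (t `^ x)%:C) ^+ m.+1 / m.+1%:R)).
  exact: cvgc_clog.
exact: cvg_muln.
Qed.

End GeneratingSeries.

(** * Estimates behind the dominated convergence *)

Section Majorant.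
Variable R : realType.
Implicit Types (t x d v : R).

(** The inequality [v / d <= e^(v/d)] raised to the power [d]. *)
Lemma expRN_le d v : 0 < d -> 0 < v -> expR (- v) <= d `^ d * v `^ (- d).
Proof.
move=> d0 v0; rewrite expRN powRN -[leLHS]mul1r ler_pdivrMr ?expR_gt0//.
rewrite mulrAC ler_pdivlMr ?powR_gt0// mul1r.
have -> : v = d * (v / d) by field; rewrite gt_eqF.
rewrite powRM ?divr_ge0 ?(ltW d0) ?(ltW v0)// ler_wpM2l ?powR_ge0//.
have -> : expR (d * (v / d)) = expR (v / d) `^ d by rewrite -expRM mulrC.
rewrite ge0_ler_powR ?nnegrE ?(ltW d0) ?expR_ge0 ?divr_ge0 ?(ltW d0) ?(ltW v0)//.
by rewrite (le_trans _ (expR_ge1Dx _))// lerDr.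
Qed.

(** With [L = - ln t], [t = e^(-L) <= 1 / (1 + L)]. The two summands on the right produce the two
    kernels of the majorant. *)
Lemma one_sub_inv_le t : 0 < t -> t < 1 -> (1 - t)^-1 <= 1 + (- ln t)^-1.
Proof.
move=> t0 t1; have L0 := lnN_gt0 t0 t1; set L := - ln t in L0 *.
have tE : t = (expR L)^-1 by rewrite -expRN /L opprK lnK.
have e1 := expR_ge1Dx L.
have h : L / (1 + L) <= 1 - t.
  have h1 : t <= (1 + L)^-1 by rewrite tE lef_pV2 ?posrE ?expR_gt0//; lra.
  have -> : L / (1 + L) = 1 - (1 + L)^-1 by field; lra.
  by rewrite lerD2l lerN2.
have -> : 1 + L^-1 = (L / (1 + L))^-1 by field; rewrite gt_eqF//; lra.
rewrite lef_pV2 ?posrE ?divr_gt0//; lra.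
Qed.

Lemma geometric_bound t N : 0 < t -> t < 1 -> \sum_(n < N) t ^+ n <= (1 - t)^-1.
Proof.
move=> t0 t1; have h : 0 < 1 - t by lra.
rewrite -[leRHS]mul1r ler_pdivlMr// mulrC.
have -> : (1 - t) * \sum_(n < N) t ^+ n = 1 - t ^+ N.
  by rewrite -(opprB t 1) mulNr -subrX1 opprB.
by rewrite gerBl exprn_ge0// ltW.
Qed.

(** [expRN_le] at [v = m x (- ln t)] trades exponential decay for a factor [m^(-d)], which makes the
    sum of [1 / m] converge, at the price of the singularity [(- ln t)^(-d)] at [t = 1]. *)
Lemma log_series_bound d x t N : 0 < d -> 0 < x -> 0 < t -> t < 1 ->
  \sum_(m < N) (t `^ x) ^+ m.+1 / m.+1%:R <=
  d `^ d * x `^ (- d) * limn (series (fun n => n.+1%:R `^ (- (1 + d)))) *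
    (- ln t) `^ (- d).
Proof.
move=> d0 x0 t0 t1; have L0 := lnN_gt0 t0 t1; set L := - ln t in L0 *.
set p := (fun n : nat => _); set K := d `^ d * x `^ (- d).
have K0 : 0 <= K by rewrite mulr_ge0 ?powR_ge0.
apply: (@le_trans _ _ (\sum_(m < N) K * L `^ (- d) * p m)).
  apply: ler_sum => m _; have m0 : 0 < m.+1%:R :> R by rewrite ltr0n.
  rewrite ler_pdivrMr//.
  have -> : (t `^ x) ^+ m.+1 = expR (- (x * L * m.+1%:R)).
    rewrite /powR gt_eqF// -expRM_natl; congr expR; rewrite /L; ring.
  have v0 : 0 < x * L * m.+1%:R by rewrite !mulr_gt0.
  rewrite (le_trans (expRN_le d0 v0))//.
  rewrite !powRM ?mulr_ge0 ?(ltW x0) ?(ltW L0)//.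
  rewrite /p opprD powRD; last by rewrite pnatr_eq0 implybT.
  rewrite powR_inv1// le_eqVlt; apply/orP; left; apply/eqP.
  by rewrite /K; field; rewrite addrC natr1 pnatr_eq0.
rewrite -mulr_sumr mulrAC ler_wpM2r ?powR_ge0// ler_wpM2l//.
apply: sumr_nat_le; first by move=> n; exact: powR_ge0.
exact: cvg_series_powR.
Qed.

End Majorant.

(** * [J] as a limit of square partial sums *)

Section JLimit.
Variable R : realType.
Variables (r : nat) (chi1 chi2 : int -> R[i]).
Hypothesis r1 : (1 < r)%N.
Variables (z : R[i]) (x : R).
Hypotheses (z1 : 1 < complex.Re z) (x0 : 0 < x).
Local Notation normc := (@Normc.normc R).
Local Notation I01 := [set` `]0, 1[] (only parsing).
Local Notation mu := (@lebesgue_measure R).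

Let r0 : (0 < r)%N. Proof. exact: ltnW. Qed.
Let z0 : 0 < complex.Re z. Proof. exact: lt_trans z1. Qed.
Let G1 (m : nat) := gauss_sum r m%:Z chi1.
Let G2 (n : nat) := gauss_sum r n%:Z chi2.
Let B1 : R := \sum_(1 <= j < r.+1) normc (chi1 j%:Z).
Let B2 : R := \sum_(1 <= j < r.+1) normc (chi2 j%:Z).
Let d : R := (complex.Re z - 1) / 2.

Let G2_per n : G2 (n + r) = G2 n.
Proof. by rewrite /G2 PoszD gauss_sum_period. Qed.

Let expo (n m : nat) : R := n.+1%:R + m.+1%:R * x.

Let expo_gt0 n m : 0 < expo n m.
Proof. by rewrite addr_gt0// mulr_gt0. Qed.

(** Product of the two truncated expansions, cut at the same [r k] so that the index set is
    symmetric; the sign is that of the logarithmic series. *)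
Let F (k : nat) (t : R) : R[i] :=
  \sum_(n < r * k) \sum_(m < r * k)
    - (G2 n.+1 * (G1 m.+1 / m.+1%:R)) * cmellin z (expo n m) t.

Let Fint k : cintegrable I01 (F k).
Proof.
apply: cintegrable_sum => // n; apply: cintegrable_sum => // m.
by apply: cintegrableZ => //; exact: cintegrable_cmellin.
Qed.

Let F_integral k : cintegral I01 (F k) = cGamma z *
  \sum_(n < r * k) \sum_(m < r * k)
    - (G2 n.+1 * (G1 m.+1 / m.+1%:R)) * cpow (expo n m) (- z).
Proof.
rewrite /F cintegral_sum//; last first.
  move=> n; apply: cintegrable_sum => // m.
  by apply: cintegrableZ => //; exact: cintegrable_cmellin.
rewrite mulr_sumr; apply: eq_bigr => n _.
rewrite cintegral_sum//; last first.
  by move=> m; apply: cintegrableZ => //; exact: cintegrable_cmellin.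
rewrite mulr_sumr; apply: eq_bigr => m _.
rewrite cintegralZ//; last exact: cintegrable_cmellin.
by rewrite cintegral_cmellinE// mulrCA.
Qed.

Let F_factor k t : 0 < t -> t < 1 -> F k t =
  cpow (- ln t) (z - 1) * (t^-1)%:C *
  (\sum_(n < r * k) G2 n.+1 * t%:C ^+ n.+1) *
  - (\sum_(m < r * k) G1 m.+1 / m.+1%:R * ((t `^ x) ^+ m.+1)%:C).
Proof.
move=> t0 t1; rewrite -mulrA mulrN mulr_suml -sumrN mulr_sumr.
apply: eq_bigr => n _; rewrite mulr_sumr -sumrN mulr_sumr.
apply: eq_bigr => m _; rewrite /cmellin /expo.
have -> : t `^ (n.+1%:R + m.+1%:R * x - 1) = t^-1 * t ^+ n.+1 * (t `^ x) ^+ m.+1.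
  have tz u v : (u + v == 0 :> R) ==> (t != 0) by rewrite (gt_eqF t0) implybT.
  rewrite powRD// powRD// powR_inv1 ?ltW// powR_mulrn ?ltW//.
  by rewrite [m.+1%:R * x]mulrC powRrM powR_mulrn ?powR_ge0//; ring.
by rewrite !rmorphM/= (rmorphXn (real_complex R) n.+1 t); ring.
Qed.

Let integrand t : R[i] :=
  cpow (ln t^-1) (z - 1) / (t * (1 - t ^+ r))%:C *
    (\sum_(1 <= l < r.+1) gauss_sum r l%:Z chi2 * (t ^+ l)%:C) *
    (\sum_(1 <= j < r.+1)
        chi1 j%:Z * clog (1 - zeta R r j%:Z * (t `^ x)%:C)).

Let F_cvg t : I01 t -> cvgc (F ^~ t) (integrand t).
Proof.
move=> /I01P[t0 t1].
have tc : normc t%:C < 1 by rewrite normc_real gtr0_norm.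
have hA := @cvgc_periodic_series R r G2 t%:C r0 G2_per tc.
have hB := cvgcN (@cvgc_log_series R r chi1 x t r0 x0 t0 t1).
rewrite opprK in hB.
have := cvgcM (cvgcMl (cpow (- ln t) (z - 1) * (t^-1)%:C) hA) hB.
have -> : cpow (- ln t) (z - 1) * (t^-1)%:C *
   ((\sum_(1 <= l < r.+1) G2 l * t%:C ^+ l) / (1 - t%:C ^+ r)) *
   (\sum_(1 <= j < r.+1) chi1 j%:Z * clog (1 - zeta R r j%:Z * (t `^ x)%:C)) =
   integrand t.
  rewrite /integrand lnV ?posrE// rmorphM/= invfM fmorphV/= rmorphB/= rmorph1 rmorphXn/=.
  under [in RHS]eq_bigr do rewrite rmorphXn/=.
  by rewrite -/G2; ring.
by apply: cvgc_eq => k; rewrite F_factor.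
Qed.

Let P : R := limn (series (fun n => n.+1%:R `^ (- (1 + d)))).
Let C : R := B1 * B2 * (d `^ d * x `^ (- d) * P).

Let d0 : 0 < d. Proof. by rewrite divr_gt0// subr_gt0. Qed.

Let major t : R := C * mellin_kernel (complex.Re z - d) 1 t +
  C * mellin_kernel d 1 t.

Let F_major k t : I01 t -> normc (F k t) <= major t.
Proof.
move=> /I01P[t0 t1]; have L0 := lnN_gt0 t0 t1.
rewrite F_factor// 3!Normc.normcM complex.normcN normc_cpow// normc_real ReCD ReCN /=.
have ti0 : 0 < t^-1 by rewrite invr_gt0.
rewrite (gtr0_norm ti0).
have B20 : 0 <= B2 by apply: sumr_ge0 => j _; exact: normc_ge0.
have B10 : 0 <= B1 by apply: sumr_ge0 => j _; exact: normc_ge0.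
have hA : normc (\sum_(n < r * k) G2 n.+1 * t%:C ^+ n.+1) <= B2 * (t * (1 - t)^-1).
  rewrite (le_trans (normc_sum _ _ _))//.
  apply: (@le_trans _ _ (\sum_(n < r * k) B2 * (t * t ^+ n))).
    apply: ler_sum => n _; rewrite Normc.normcM normcX normc_real gtr0_norm// exprS.
    by rewrite ler_wpM2r ?mulr_ge0 ?exprn_ge0 ?(ltW t0)//; exact: normc_gauss_sum.
  by rewrite -!mulr_sumr ler_wpM2l// ler_wpM2l ?(ltW t0)// geometric_bound.
have hB : normc (\sum_(m < r * k) G1 m.+1 / m.+1%:R * ((t `^ x) ^+ m.+1)%:C) <=
    B1 * (d `^ d * x `^ (- d) * P * (- ln t) `^ (- d)).
  rewrite (le_trans (normc_sum _ _ _))//.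
  apply: (@le_trans _ _ (\sum_(m < r * k) B1 * ((t `^ x) ^+ m.+1 / m.+1%:R))).
    apply: ler_sum => m _; rewrite !Normc.normcM Normc.normcV normc_nat normc_real.
    rewrite ger0_norm ?exprn_ge0 ?powR_ge0//.
    rewrite mulrAC -mulrA ler_wpM2r ?divr_ge0 ?exprn_ge0 ?powR_ge0//.
    exact: normc_gauss_sum.
  by rewrite -mulr_sumr ler_wpM2l// log_series_bound.
apply: (@le_trans _ _ ((- ln t) `^ (complex.Re z - 1) * t^-1 * (B2 * (t * (1 - t)^-1)) *
   (B1 * (d `^ d * x `^ (- d) * P * (- ln t) `^ (- d))))).
  rewrite ler_pM ?mulr_ge0 ?normc_ge0 ?powR_ge0 ?(ltW ti0)//.
  by rewrite ler_wpM2l// mulr_ge0 ?powR_ge0 ?(ltW ti0).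
have P0 : 0 <= P.
  have := @sumr_nat_le R (fun n => n.+1%:R `^ (- (1 + d))) _ (cvg_series_powR d0) 0.
  by rewrite big_ord0; apply => n; exact: powR_ge0.
have C0 : 0 <= C by rewrite /C !mulr_ge0// powR_ge0.
(* The power series starts at exponent 1, and this factor [t] cancels [t^-1]. *)
rewrite [leLHS](_ : _ = C * ((- ln t) `^ (complex.Re z - 1) * (- ln t) `^ (- d)) * (1 - t)^-1); last first.
  by rewrite /C; field; rewrite !gt_eqF//; lra.
have Lz u v : (u + v == 0 :> R) ==> (- ln t != 0) by rewrite (gt_eqF L0) implybT.
rewrite -powRD//; rewrite /major -mulrDr -mulrA ler_wpM2l//.
rewrite /mellin_kernel subrr powRr0 !mulr1.
(* By [s - 1 = 2 d], the kernel of exponent [d] is the one of exponent [s - d] times [1 / (- ln t)];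
   the two together match [1 + 1 / (- ln t)] of [one_sub_inv_le]. *)
have -> : d - 1 = (complex.Re z - 1 - d) + (-1) by rewrite /d; field.
rewrite [X in _ <= _ + X]powRD// [complex.Re z - d - 1]addrAC powR_inv1 ?(ltW L0)//.
rewrite -[X in _ <= X + _]mulr1 -mulrDr ler_wpM2l ?powR_ge0//.
exact: one_sub_inv_le.
Qed.

Let major_integrable : mu.-integrable I01 (EFin \o major).
Proof.
apply: integrable_lincomb => //; apply: integrable_mellin_kernel => //.
by have h := z1; rewrite /d; lra.
Qed.

Lemma cvgc_J : cvgc (fun k => \sum_(n < r * k) \sum_(m < r * k)
    - (gauss_sum r n.+1%:Z chi2 * (gauss_sum r m.+1%:Z chi1 / m.+1%:R)) *
      cpow (n.+1%:R + m.+1%:R * x) (- z))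
  (J r chi1 chi2 z x).
Proof.
have h : cvgc (fun k => cintegral I01 (F k)) (cintegral I01 integrand).
  apply: (@cintegral_dominated R I01 F integrand major).
  - exact: measurable_itv.
  - by move=> k; exact: cintegrable_measurable.
  - exact: F_cvg.
  - exact: major_integrable.
  - exact: F_major.
have := cvgcMl (cGamma z)^-1 h; rewrite -/(J r chi1 chi2 z x).
by apply: cvgc_eq => k; rewrite F_integral mulKf// cGamma_neq0.
Qed.

End JLimit.

(** * The combined double series *)

Section DoubleSeriesBound.
Variable R : realType.
Local Notation normc := (@Normc.normc R).

(** The numerators are arbitrary bounded numbers, so that Gauss sums and conjugate character values
    are covered alike. *)
Lemma double_summand_bound (z : R[i]) (x : R) (n m : nat) (c1 c2 : R[i]) (b1 b2 : R) :
  1 < complex.Re z -> 0 < x -> normc c1 <= b1 -> normc c2 <= b2 ->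
  normc (c1 * c2 / (m.+1%:R * n.+1%:R * cpow (n.+1%:R + m.+1%:R * x) (z - 1))) <=
  b1 * b2 * x `^ (- ((complex.Re z - 1) / 2)) *
    (n.+1%:R `^ (- (1 + (complex.Re z - 1) / 2)) *
     m.+1%:R `^ (- (1 + (complex.Re z - 1) / 2))).
Proof.
move=> z1 x0 hc1 hc2; set d := (complex.Re z - 1) / 2.
have d0 : 0 < d by rewrite divr_gt0// subr_gt0.
have n0 : 0 < n.+1%:R :> R by rewrite ltr0n.
have m0 : 0 < m.+1%:R :> R by rewrite ltr0n.
set v := n.+1%:R + m.+1%:R * x.
have mx0 : 0 < m.+1%:R * x by rewrite mulr_gt0.
have v0 : 0 < v by rewrite addr_gt0.
rewrite Normc.normcM Normc.normcV 3!Normc.normcM !normc_nat normc_cpow// ReCD ReCN /=.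
have -> : complex.Re z - 1 = d + d by rewrite /d; field.
have vd : (n.+1%:R `^ d) * (m.+1%:R `^ d * x `^ d) <= v `^ (d + d).
  rewrite powRD; last by rewrite (gt_eqF v0) implybT.
  rewrite -powRM ?(ltW m0) ?(ltW x0)// ler_pM ?powR_ge0//.
    by rewrite ge0_ler_powR ?nnegrE ?(ltW d0) ?(ltW n0) ?(ltW v0)// lerDl ltW.
  by rewrite ge0_ler_powR ?nnegrE ?(ltW d0) ?(ltW mx0) ?(ltW v0)// lerDr ltW.
have nd0 := powR_gt0 d n0; have md0 := powR_gt0 d m0; have xd0 := powR_gt0 d x0.
have hn w : 0 < w -> w `^ (- (1 + d)) = w^-1 * (w `^ d)^-1.
  move=> w0; rewrite opprD powRD; last by rewrite (gt_eqF w0) implybT.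
  by rewrite powR_inv1 ?ltW// powRN.
rewrite !hn// [x `^ (- d)]powRN.
rewrite [leRHS](_ : _ = b1 * b2 * (m.+1%:R * n.+1%:R * (n.+1%:R `^ d * (m.+1%:R `^ d * x `^ d)))^-1); last first.
  by field; rewrite !gt_eqF.
rewrite ler_pM ?mulr_ge0 ?normc_ge0//.
- by rewrite invr_ge0 !mulr_ge0 ?powR_ge0 ?(ltW n0) ?(ltW m0).
- by rewrite ler_pM ?normc_ge0.
- rewrite lef_pV2 ?posrE ?mulr_gt0 ?powR_gt0//.
  by rewrite ler_wpM2l// mulr_ge0 ?(ltW n0) ?(ltW m0).
Qed.

(** Since [n + m x = x (m + n / x)], the factor [x^(1-z)] turns [(m + n/x)^(-z)] into
    [x (n + m x)^(-z)]. Adding the coefficients then releases one factor [n + m x], which lowers the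
    exponent from [z] to [z - 1]. *)
Lemma reciprocity_summand (z g1 g2 : R[i]) (x : R) (n m : nat) : 0 < x ->
  - (g2 * (g1 / m.+1%:R)) * cpow (n.+1%:R + m.+1%:R * x) (- z) +
  cpow x (1 - z) *
    (- (g1 * (g2 / n.+1%:R)) * cpow (m.+1%:R + n.+1%:R * x^-1) (- z)) =
  - (g1 * g2 / (m.+1%:R * n.+1%:R * cpow (n.+1%:R + m.+1%:R * x) (z - 1))).
Proof.
move=> x0.
have n0 : 0 < n.+1%:R :> R by rewrite ltr0n.
have m0 : 0 < m.+1%:R :> R by rewrite ltr0n.
set v := n.+1%:R + m.+1%:R * x.
have v0 : 0 < v by rewrite addr_gt0// mulr_gt0.
have w0 : 0 < m.+1%:R + n.+1%:R * x^-1 by rewrite addr_gt0// divr_gt0.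
have hv : cpow x (1 - z) * cpow (m.+1%:R + n.+1%:R * x^-1) (- z) = x%:C * cpow v (- z).
  have -> : v = x * (m.+1%:R + n.+1%:R * x^-1).
    by rewrite mulrDr mulrCA divff ?gt_eqF// mulr1 addrC [x * _]mulrC.
  by rewrite [cpow x (1 - z)]cpowD cpow1// -mulrA -cpowM.
have hvi : (cpow v (z - 1))^-1 = v%:C * cpow v (- z).
  by rewrite -cpowN opprB cpowD cpow1.
rewrite [cpow x _ * _]mulrCA hv invfM hvi.
have -> : v%:C = n.+1%:R + m.+1%:R * x%:C by rewrite /v rmorphD rmorphM/= -!natrC.
have hn : n.+1%:R != 0 :> R[i] by rewrite pnatr_eq0.
have hm : m.+1%:R != 0 :> R[i] by rewrite pnatr_eq0.
move: hn hm; move: (n.+1%:R : R[i]) (m.+1%:R : R[i]) => n' m' hn hm.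
by field; rewrite hn.
Qed.

End DoubleSeriesBound.

Theorem theorem1p4 (R : realType) (r : nat) (hr : (1 < r)%N)
    (chi1 chi2 : int -> R[i])
    (hchi1 : dirichlet_character r chi1) (hchi2 : dirichlet_character r chi2)
    (z : R[i]) (hz : 1 < complex.Re z) (x : R) (hx : 0 < x) :
  let lhs := J r chi1 chi2 z x + cpow x (1 - z) * J r chi2 chi1 z x^-1 in
  let a (n m : nat) : R[i] :=
    gauss_sum r m%:Z chi1 * gauss_sum r n%:Z chi2 /
    (m%:R * n%:R * cpow (n%:R + m%:R * x) (z - 1)) in
  let b (n m : nat) : R[i] :=
    (chi1 m%:Z)^* * (chi2 n%:Z)^* /
    (m%:R * n%:R * cpow (n%:R + m%:R * x) (z - 1)) in
  (iterated_cvg a /\ lhs = - iterated_sum a) /\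
  (primitive_character r chi1 -> primitive_character r chi2 ->
   iterated_cvg b /\
   lhs = - (gauss_sum r 1 chi1 * gauss_sum r 1 chi2 * iterated_sum b)).
Proof.
move=> lhs a b.
have r0 : (0 < r)%N by exact: ltnW.
pose d := (complex.Re z - 1) / 2.
have d0 : 0 < d by rewrite divr_gt0// subr_gt0.
pose p n : R := n.+1%:R `^ (- (1 + d)).
have p0 n : 0 <= p n by exact: powR_ge0.
have square := @iterated_square R ^~ p.
have cp : cvgn (series p) by exact: cvg_series_powR.
have rk := cvg_muln r0.
have lhsE : cvgc (fun k => - \sum_(n < r * k) \sum_(m < r * k) a n.+1 m.+1) lhs.
  have xi0 : 0 < x^-1 by rewrite invr_gt0.
  have := cvgcD (cvgc_J chi1 chi2 hr hz hx)
    (cvgcMl (cpow x (1 - z)) (cvgc_J chi2 chi1 hr hz xi0)).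
  (* In the expansion of the second [J] the outer index belongs to [chi1]; a finite exchange on the
     same square aligns it with the first. *)
  apply: cvgc_eq => k; rewrite [in X in _ + _ * X]exchange_big mulr_sumr -big_split -sumrN.
  apply: eq_bigr => n _; rewrite mulr_sumr -big_split -sumrN.
  by apply: eq_bigr => m _; exact: reciprocity_summand.
have [cvga suma] := square a _ _ p0 cp
  (fun n m => double_summand_bound n m hz hx (normc_gauss_sum r chi1 m.+1%:Z)
    (normc_gauss_sum r chi2 n.+1%:Z)) rk.
split; first by split => //; exact: cvgc_unique lhsE (cvgcN suma).
move=> prim1 prim2.
have [cvgb sumb] := square b _ _ p0 cp
  (fun n m => double_summand_bound n m hz hx (normc_conj_chi_le1 r0 hchi1 m.+1%:Z)
    (normc_conj_chi_le1 r0 hchi2 n.+1%:Z)) rk.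
split => //; apply: (cvgc_unique lhsE); apply: cvgcN.
have := cvgcMl (gauss_sum r 1 chi1 * gauss_sum r 1 chi2) sumb.
apply: cvgc_eq => k; rewrite mulr_sumr; apply: eq_bigr => n _.
rewrite mulr_sumr; apply: eq_bigr => m _.
rewrite /a (gauss_sum_primitive m.+1%:Z r0 prim1) (gauss_sum_primitive n.+1%:Z r0 prim2).
by rewrite /b; ring.
Qed.
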